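(* Let $X$ be a piecewise deterministic Markov process satisfying the assumptions of the context, and suppose in addition that $E_{\pi_Q}(T_1)<\infty$, where $\pi_Q(B)=\frac1{\|\xi\|}\big(\int_{\mathbb E}\lambda(x)\mu_x(B)\,\nu(dx)+\int_\Gamma\mu_x(B)\,\sigma(dx)\big)$ with $\|\xi\|=\int_{\mathbb E}\lambda\,d\nu+\sigma(\Gamma)$. Fix $i\in K$ and suppose that $r_i(x)\neq0$ for all $x\in\mathbb E_i^\circ$. (a) If $d_i=1$, then $\nu$ is absolutely continuous on $\mathbb E_i$. (b) In general (i.e. for arbitrary $d_i\ge1$), $\nu$ is absolutely continuous on $\mathbb E_i$ if $\pi_Q$ is absolutely continuous on $\mathbb E_i$ and $r_i$ is continuously differentiable. Here absolute continuity on $\mathbb E_i$ is with respect to $d_i$-dimensional Lebesgue measure.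
   Context: **PDMP.** Let $K=\{1,\dots,k\}$. For $i\in K$ let $\mathbb E_i^\circ\subseteq\mathbb R^{d_i}$ be open with boundary $\partial\mathbb E_i$, and let $r_i:\mathbb E_i^\circ\to\mathbb R^{d_i}$ be locally Lipschitz. The flow $\varphi_i(x,t)$ is the unique (non-exploding) solution of $\partial_t\varphi_i(x,t)=r_i(\varphi_i(x,t))$, $\varphi_i(x,0)=x$, followed (in both time directions) until it leaves $\mathbb E_i^\circ$ and extended by continuity to the boundary points where it leaves or enters. The active boundary is $\Gamma_i=\{z\in\partial\mathbb E_i: z=\varphi_i(x,t)\text{ for some }x\in\mathbb E_i^\circ,t>0\}$, the passive boundary is $\Gamma_i^\star=\{z\in\partial\mathbb E_i: z=\varphi_i(x,-t)\text{ for some }x\in\mathbb E_i^\circ,t>0\}$; $\mathbb E_i=\mathbb E_i^\circ\cup\Gamma_i^\star$. The symbols $\mathbb E^\circ,\mathbb E,\Gamma,\Gamma^\star$ denote the disjoint unions over $i\in K$; the index $i$ is often suppressed. Let $\tau(x)=\inf\{t\ge0:\varphi(x,t)\in\Gamma\}$ ($\inf\emptyset=\infty$). Given a measurable jump intensity $\lambda:\mathbb E\to[0,\infty)$ and jump measures $\mu_x$ (probability measures on $\mathbb E$, $x\in\mathbb E\cup\Gamma$), the PDMP $X$ with state space $\mathbb E$ started at $x$ follows $X_t=\varphi(x,t)$ for $t<T_1$, where $P_x(T_1>t)=1_{\{t<\tau(x)\}}\exp(-\int_0^t\lambda(\varphi(x,u))\,du)$; at $T_1$ it jumps to a point with distribution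 $\mu_{\varphi(x,T_1)}$ and restarts from there. $T_1<T_2<\dots$ are the jump times, $N_t$ is the number of jumps in $[0,t]$, and $N_t^+(B)$, $B\subseteq\Gamma$ Borel, is the number of jumps in $[0,t]$ at which $X_{T_n-}\in B$ (forced jumps). **Notation.** $\tau(x,B)=t$ if the flow from $x$ reaches $B$ (first) at time $t\ge0$, $=\infty$ if it never does; $\partial_hB=\{x\in\mathbb E:\tau(x,B)<h\}$. $E_\mu$ is expectation when $X_0$ has distribution $\mu$. **Standing assumptions.** (A1) For each $x\in\mathbb E$ there is $\varepsilon(x)>0$ with $\int_0^{\varepsilon(x)}\lambda(\varphi(x,s))ds<\infty$. (A2) $\int_0^\infty\lambda(\varphi(x,s))ds=\infty$ whenever $\tau(x)=\infty$. (A3) $E_x(N_t)<\infty$ for all $x\in\mathbb E,t>0$. (A4) $\mu_x(\{x\})=0$ for all $x\in\mathbb E$. (B1) There is a stationary distribution $\nu$ of $X$ on $\mathbb E$ (fixed throughout). (B2) $\int_{\mathbb E}\lambda\,d\nu<\infty$. (B3) $\lambda$ is continuous. (B4) For Borel $A\subseteq\mathbb E$ and $x\in\mathbb E$, $\mu_{\varphi(x,h)}(A)\to\mu_x(A)$ as $h\to0$. (B5) $\mu_x(\partial_h\Gamma)\to0$ as $h\to0$ uniformly in $x\in\Gamma$. **Boundary measure.** $\sigma$ is the finite measure on $\Gamma$ with $\sigma(B)=E_\nu(N_t^+(B))/t$ for every $t>0$ and Borel $B\subseteq\Gamma$. It is known that $\|\xi\|$ is finite and strictly positive; $\pi_Q$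 is a stationary distribution of the post-jump chain $Q_k=X_{T_k}$.
   Formalization: Absolute continuity on E_i is taken with respect to Lebesgue measure on the open set E_i°; this matters only if Γ_i* has positive Lebesgue measure, where (b) then also requires π_Q(Γ_i* )=0, since (b) as stated fails for such boundaries. *)

(* Defs.v *)
From HB Require Import structures.
From mathcomp Require Import all_boot all_order all_algebra.
From mathcomp Require Import all_classical all_reals all_analysis.

Set Implicit Arguments.
Unset Strict Implicit.
Unset Printing Implicit Defensive.

Import Order.TTheory GRing.Theory Num.Theory.
Import numFieldNormedType.Exports.

Local Open Scope classical_set_scope.
Local Open Scope ring_scope.

(* The modes are K = 'I_k.+1.  [hybrid R d] is the disjoint union over K of the
   spaces R^(d j), with the disjoint union topology and its Borel sets. *)
Definition hybrid (R : realType) (k : nat) (d : 'I_k.+1 -> nat) : Type :=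
  {j : 'I_k.+1 & 'rV[R]_(d j)}.
Arguments hybrid R {k} d.

HB.instance Definition _ (R : realType) (k : nat) (d : 'I_k.+1 -> nat) :=
  Topological.copy (hybrid R d) {j : 'I_k.+1 & 'rV[R]_(d j)}.
HB.instance Definition _ (R : realType) (k : nat) (d : 'I_k.+1 -> nat) :=
  isPointed.Build (hybrid R d)
    (existT (fun j => 'rV[R]_(d j)) ord0 (0 : 'rV[R]_(d ord0))).
HB.instance Definition _ (R : realType) (k : nat) (d : 'I_k.+1 -> nat) :=
  @isMeasurable.Build (sigma_display (@open (hybrid R d))) (hybrid R d)
    <<s @open (hybrid R d) >> (@sigma_algebra0 _ setT _) (@sigma_algebraC _ _)
    (@sigma_algebra_bigcup _ setT _).

(* Lebesgue outer measure on R^n (n >= 1), from countable covers by boxes; on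
   Borel sets it is n-dimensional Lebesgue measure. *)
Definition lebesgue_rV (R : realType) (n : nat) (A : set 'rV[R]_n) : \bar R :=
  ereal_inf [set v | exists a b : nat -> 'rV[R]_n,
    [/\ forall m j, a m ord0 j <= b m ord0 j,
        A `<=` \bigcup_m [set x | forall j, a m ord0 j <= x ord0 j <= b m ord0 j]
      & v = (\sum_(m <oo) (\prod_j (b m ord0 j - a m ord0 j))%:E)%E]].

Definition continuously_differentiable (R : realType) (n : nat)
    (D : set 'rV[R]_n) (f : 'rV[R]_n -> 'rV[R]_n) : Prop :=
  forall x, D x -> differentiable f x /\ {for x, continuous (jacobian f)}.

(* [phi] is total, but its values are constrained only up to the first time (in
   each direction) at which the solution leaves [D].  The two limit clauses say
   that the solution does not explode and is extended by continuity to the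
   boundary point where it leaves or enters; the last clause says that from an
   entrance point the flow follows the orbit that starts there, so that such an
   orbit is unique. *)
Record is_flow (R : realType) (n : nat) (D : set 'rV[R]_n)
    (r : 'rV[R]_n -> 'rV[R]_n) (phi : 'rV[R]_n -> R -> 'rV[R]_n) : Prop := {
  flow0 : forall x, D x -> phi x 0 = x ;
  flow_ode : forall x t, D x ->
    (forall s, (0 <= s <= t) || (t <= s <= 0) -> D (phi x s)) ->
    is_derive t 1 (phi x) (r (phi x t)) ;
  flow_exit : forall x t, D x -> 0 < t ->
    (forall s, 0 <= s < t -> D (phi x s)) ->
    phi x s @[s --> t^'-] --> phi x t ;
  flow_entrance : forall x t, D x -> t < 0 ->
    (forall s, t < s <= 0 -> D (phi x s)) ->
    phi x s @[s --> t^'+] --> phi x t ;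
  flow_from_entrance : forall x t, D x -> t < 0 ->
    (forall s, t < s <= 0 -> D (phi x s)) -> ~ D (phi x t) ->
    forall u, 0 <= u ->
      (forall s, 0 <= s < t + u -> D (phi x s)) ->
      phi (phi x t) u = phi x (t + u) }.

(* [dom j] is the open set E_j°, [vf j] the vector field r_j, [rate] is lambda
   and [jump x] is mu_x.  Only the values of [vf j] on [dom j], of [rate] on E
   and of [jump] on E and the active boundary matter. *)
Record characteristics (R : realType) (k : nat) (d : 'I_k.+1 -> nat) := {
  dom : forall j, set 'rV[R]_(d j) ;
  vf : forall j, 'rV[R]_(d j) -> 'rV[R]_(d j) ;
  flow : forall j, 'rV[R]_(d j) -> R -> 'rV[R]_(d j) ;
  rate : hybrid R d -> R ;
  jump : R.-pker (hybrid R d) ~> (hybrid R d) }.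

Definition hflow (R : realType) (k : nat) (d : 'I_k.+1 -> nat)
    (C : characteristics R d) (x : hybrid R d) (t : R) : hybrid R d :=
  existT _ (projT1 x) (flow C (projT2 x) t).

Definition inner (R : realType) (k : nat) (d : 'I_k.+1 -> nat)
    (C : characteristics R d) : set (hybrid R d) :=
  [set x | dom C (projT2 x)].

(* The condition on [s] selects the (first) point where the orbit leaves E°. *)
Definition active_boundary (R : realType) (k : nat) (d : 'I_k.+1 -> nat)
    (C : characteristics R d) : set (hybrid R d) :=
  [set z | (closure (inner C) `\` inner C) z /\
    exists x t, [/\ inner C x, 0 < t,
      forall s, 0 <= s < t -> inner C (hflow C x s) & z = hflow C x t]].

Definition passive_boundary (R : realType) (k : nat) (d : 'I_k.+1 -> nat)
    (C : characteristics R d) : set (hybrid R d) :=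
  [set z | (closure (inner C) `\` inner C) z /\
    exists x t, [/\ inner C x, 0 < t,
      forall s, 0 <= s < t -> inner C (hflow C x (- s)) & z = hflow C x (- t)]].

Definition state_space (R : realType) (k : nat) (d : 'I_k.+1 -> nat)
    (C : characteristics R d) : set (hybrid R d) :=
  inner C `|` passive_boundary C.

Definition exit_time (R : realType) (k : nat) (d : 'I_k.+1 -> nat)
    (C : characteristics R d) (x : hybrid R d) : \bar R :=
  ereal_inf [set t%:E | t in
    [set t : R | 0 <= t /\ active_boundary C (hflow C x t)]].

(* The set written \partial_h Gamma. *)
Definition exits_before (R : realType) (k : nat) (d : 'I_k.+1 -> nat)
    (C : characteristics R d) (h : R) : set (hybrid R d) :=
  [set x | state_space C x /\ (exit_time C x < h%:E)%E].

Definition cumulated_rate (R : realType) (k : nat) (d : 'I_k.+1 -> nat)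
    (C : characteristics R d) (x : hybrid R d) (I : set R) : \bar R :=
  (\int[lebesgue_measure]_(u in I) (rate C (hflow C x u))%:E)%E.

(* P_x(T_1 > t) *)
Definition survival (R : realType) (k : nat) (d : 'I_k.+1 -> nat)
    (C : characteristics R d) (x : hybrid R d) (t : R) : \bar R :=
  if (t%:E < exit_time C x)%E then expeR (- cumulated_rate C x `[0%R, t])%E
  else 0%E.

Record is_characteristics (R : realType) (k : nat) (d : 'I_k.+1 -> nat)
    (C : characteristics R d) : Prop := {
  dom_open : forall j, open (@dom R k d C j) ;
  vf_lipschitz : forall j, [locally [lipschitz (vf C x) | x in @dom R k d C j]] ;
  flowP : forall j, is_flow (@dom R k d C j) (@vf R k d C j) (@flow R k d C j) ;
  measurable_state_space : measurable (state_space C) ;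
  measurable_active_boundary : measurable (active_boundary C) ;
  rate_ge0 : forall x, state_space C x -> 0 <= rate C x ;
  measurable_rate : measurable_fun (state_space C) (rate C) ;
  jump_state_space : forall x, (state_space C `|` active_boundary C) x ->
    jump C x (state_space C) = 1%E }.

(* X_{T_(n+1)-}, the position just before the (n+1)-st jump. *)
Definition prejump (R : realType) (k : nat) (d : 'I_k.+1 -> nat)
    (C : characteristics R d) (Omega : Type)
    (T : nat -> Omega -> R) (Q : nat -> Omega -> hybrid R d)
    (n : nat) (w : Omega) : hybrid R d :=
  hflow C (Q n w) (T n.+1 w - T n w).

(* The events generated by Q_0, ..., Q_n and T_0, ..., T_m. *)
Definition history (R : realType) (k : nat) (d : 'I_k.+1 -> nat)
    (Omega : Type) (T : nat -> Omega -> R) (Q : nat -> Omega -> hybrid R d)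
    (n m : nat) : set (set Omega) :=
  <<s [set F |
    (exists l A, [/\ (l <= n)%N, measurable A & F = Q l @^-1` A]) \/
    (exists l B, [/\ (l <= m)%N, measurable B & F = T l @^-1` B])] >>.

(* T n (n >= 1) is the n-th jump time, T 0 = 0, Q n is the position right after
   T n, Q 0 the starting point, and [P x] is the law when the start is x. *)
Record is_pdmp (R : realType) (k : nat) (d : 'I_k.+1 -> nat)
    (C : characteristics R d)
    (dO : measure_display) (Omega : measurableType dO)
    (P : R.-pker (hybrid R d) ~> Omega) (X : R -> Omega -> hybrid R d)
    (T : nat -> Omega -> R) (Q : nat -> Omega -> hybrid R d) : Prop := {
  measurable_X : forall t, 0 <= t -> measurable_fun setT (X t) ;
  measurable_T : forall n, measurable_fun setT (T n) ;
  measurable_Q : forall n, measurable_fun setT (Q n) ;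
  measurable_prejump : forall n, measurable_fun setT (prejump C T Q n) ;
  X_state : forall t w, 0 <= t -> state_space C (X t w) ;
  Q_state : forall n w, state_space C (Q n w) ;
  T_start : forall w, T 0%N w = 0 ;
  T_nondecreasing : forall n w, T n w <= T n.+1 w ;
  X_path : forall n w t, T n w <= t < T n.+1 w ->
    X t w = hflow C (Q n w) (t - T n w) ;
  Q_start : forall x, state_space C x -> P x (Q 0%N @^-1` [set x]) = 1%E ;
  jump_time_law : forall x n F t, state_space C x ->
    history T Q n n F -> 0 <= t ->
    P x (F `&` [set w | t < T n.+1 w - T n w]) =
    (\int[P x]_(w in F) survival C (Q n w) t)%E ;
  postjump_law : forall x n F A, state_space C x ->
    history T Q n n.+1 F -> measurable A ->
    P x (F `&` Q n.+1 @^-1` A) =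
    (\int[P x]_(w in F) jump C (prejump C T Q n w) A)%E }.

(* N_t *)
Definition jump_count (R : realType) (Omega : Type) (T : nat -> Omega -> R)
    (t : R) (w : Omega) : \bar R :=
  (\sum_(n <oo) ((T n.+1 w <= t)%R%:R)%:E)%E.

(* N_t^+(B), for B included in the active boundary *)
Definition forced_jump_count (R : realType) (k : nat) (d : 'I_k.+1 -> nat)
    (C : characteristics R d) (Omega : Type)
    (T : nat -> Omega -> R) (Q : nat -> Omega -> hybrid R d)
    (B : set (hybrid R d)) (t : R) (w : Omega) : \bar R :=
  (\sum_(n <oo) (((T n.+1 w <= t)%R && `[< B (prejump C T Q n w) >])%:R)%:E)%E.

(* E_mu(Y) *)
Definition expect (R : realType) (k : nat) (d : 'I_k.+1 -> nat)
    (C : characteristics R d)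
    (dO : measure_display) (Omega : measurableType dO)
    (P : R.-pker (hybrid R d) ~> Omega) (mu : probability (hybrid R d) R)
    (Y : Omega -> \bar R) : \bar R :=
  (\int[mu]_(x in state_space C) \int[P x]_w Y w)%E.

Definition is_stationary (R : realType) (k : nat) (d : 'I_k.+1 -> nat)
    (C : characteristics R d)
    (dO : measure_display) (Omega : measurableType dO)
    (P : R.-pker (hybrid R d) ~> Omega) (X : R -> Omega -> hybrid R d)
    (nu : probability (hybrid R d) R) : Prop :=
  nu (state_space C) = 1%E /\
  forall t A, 0 <= t -> measurable A ->
    (\int[nu]_(x in state_space C) P x (X t @^-1` A))%E = nu A.

Record assumptions_A (R : realType) (k : nat) (d : 'I_k.+1 -> nat)
    (C : characteristics R d)
    (dO : measure_display) (Omega : measurableType dO)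
    (P : R.-pker (hybrid R d) ~> Omega) (T : nat -> Omega -> R) : Prop := {
  A1 : forall x, state_space C x ->
    exists2 e : R, 0 < e & (cumulated_rate C x `[0%R, e] < +oo)%E ;
  A2 : forall x, state_space C x -> exit_time C x = +oo%E ->
    cumulated_rate C x `[0, +oo[ = +oo%E ;
  A3 : forall x t, state_space C x -> 0 < t ->
    (\int[P x]_w jump_count T t w < +oo)%E ;
  A4 : forall x, state_space C x -> jump C x [set x] = 0%E }.

Record assumptions_B (R : realType) (k : nat) (d : 'I_k.+1 -> nat)
    (C : characteristics R d)
    (dO : measure_display) (Omega : measurableType dO)
    (P : R.-pker (hybrid R d) ~> Omega) (X : R -> Omega -> hybrid R d)
    (nu : probability (hybrid R d) R) : Prop := {
  B1 : is_stationary C P X nu ;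
  B2 : (\int[nu]_(x in state_space C) (rate C x)%:E < +oo)%E ;
  B3 : {within state_space C, continuous (rate C)} ;
  B4 : forall A x, measurable A -> A `<=` state_space C -> state_space C x ->
    jump C (hflow C x h) A @[h --> 0^'+] --> jump C x A ;
  B5 : forall e : R, 0 < e -> \forall h \near 0^'+,
    forall x, active_boundary C x -> (jump C x (exits_before C h) < e%:E)%E }.

Definition is_boundary_measure (R : realType) (k : nat) (d : 'I_k.+1 -> nat)
    (C : characteristics R d)
    (dO : measure_display) (Omega : measurableType dO)
    (P : R.-pker (hybrid R d) ~> Omega)
    (T : nat -> Omega -> R) (Q : nat -> Omega -> hybrid R d)
    (nu : probability (hybrid R d) R)
    (sigma : {finite_measure set (hybrid R d) -> \bar R}) : Prop :=
  sigma (~` active_boundary C) = 0%E /\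
  forall B t, measurable B -> B `<=` active_boundary C -> 0 < t ->
    sigma B = (expect C P nu (forced_jump_count C T Q B t) * (t^-1)%:E)%E.

(* \|xi\| *)
Definition xi_mass (R : realType) (k : nat) (d : 'I_k.+1 -> nat)
    (C : characteristics R d) (nu : probability (hybrid R d) R)
    (sigma : {finite_measure set (hybrid R d) -> \bar R}) : \bar R :=
  (\int[nu]_(x in state_space C) (rate C x)%:E + sigma (active_boundary C))%E.

Definition is_piQ (R : realType) (k : nat) (d : 'I_k.+1 -> nat)
    (C : characteristics R d) (nu : probability (hybrid R d) R)
    (sigma : {finite_measure set (hybrid R d) -> \bar R})
    (piQ : probability (hybrid R d) R) : Prop :=
  forall B, measurable B -> piQ B =
    ((fine (xi_mass C nu sigma))^-1%:E *
     (\int[nu]_(x in state_space C) ((rate C x)%:E * jump C x B) +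
      \int[sigma]_(x in active_boundary C) jump C x B))%E.

(* Absolute continuity on E_i.  The reference measure on E_i is the
   d_i-dimensional Lebesgue measure of the open set E_i°: boundary points carry
   no volume.  It is the restriction of Lebesgue measure to E_i as soon as the
   part of the boundary contained in E_i is Lebesgue null. *)
Definition abs_continuous_on (R : realType) (k : nat) (d : 'I_k.+1 -> nat)
    (C : characteristics R d) (i : 'I_k.+1) (m : probability (hybrid R d) R)
    : Prop :=
  forall A, measurable A -> A `<=` state_space C ->
    (forall x, A x -> projT1 x = i) ->
    lebesgue_rV (existT (fun j => 'rV[R]_(d j)) i @^-1` (A `&` inner C)) = 0%E ->
    m A = 0%E.

(* Main.v *)
Require Import Defs.
From HB Require Import structures.
From mathcomp Require Import all_boot all_order all_algebra.
From mathcomp Require Import all_classical all_reals all_analysis.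
From mathcomp Require Import measurable_realfun.
From mathcomp Require Import ring lra.

Set Implicit Arguments.
Unset Strict Implicit.
Unset Printing Implicit Defensive.

Import Order.TTheory GRing.Theory Num.Theory.
Import numFieldNormedType.Exports.

Local Open Scope classical_set_scope.
Local Open Scope ring_scope.

(** Let PP be the mixture over nu of the laws of the process.  Under PP the
    position at any fixed time s >= 0 has law nu.  Let A be a Borel subset of
    E_i whose inner part is Lebesgue null.

    The heart of the matter is that a sojourn which begins with a jump spends
    almost no time in A.  This suffices: at time s the process either has not
    jumped yet, an event whose probability tends to 0 as s grows, or is in one
    of the sojourns that follow a jump, since it does not explode.  By Fubini
    the second alternative contributes PP-null events to A at almost every s,
    so nu A <= PP (s < T_1) for arbitrarily large s ([null_of_sojourns]).

    In dimension one the time that an orbit spends in A is null for every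
    starting point: the speed does not vanish, so that the orbit locally
    separates distinct times at least linearly, and such a map pulls null sets
    back to null sets ([derive_neq0_hnull]).

    In higher dimension a single orbit may stay in A, and the randomness of the
    post-jump position has to be used.  By Fubini it is enough that for each
    age u > 0 almost no sojourn starts in the set B_u of points whose orbit
    lies in A at age u.  Two facts give this.

    First, B_u is Lebesgue null.  The field is locally Lipschitz, hence by
    Gronwall's inequality read backwards in time ([gronwall_backward]) two
    orbits that remain close on [0, u] were at time 0 at most a constant times
    as far apart as at time u.  Countably many sets of starting points, each
    with its own constant, exhaust the points alive at age u, and on each of
    them null sets pull back to null sets ([flow_preimage_hnull]).

    Second, a set B with piQ B = 0 contains almost surely no post-jump position
    ([postjump_null]).  Let Z be the set of points from which a jump leads to B
    with positive probability.  The formula for piQ says that sigma vanishes on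
    the part of Z in the active boundary and that nu vanishes on the part of Z
    where the rate is positive.  The former excludes forced jumps from Z, as
    sigma counts them ([forced_jump_null]).  The latter, by stationarity and
    Fubini, says that a sojourn visits that part of Z at almost no age
    ([sojourn_avoids_null]).  Since the length of a sojourn has hazard rate
    lambda along the orbit, its law ignores null sets of ages as well as the
    ages at which lambda vanishes ([exp_law_null]); so no sojourn ends with a
    spontaneous jump from Z ([first_jump_avoids], [sojourn_law_avoids]).

    With B = B_u, absolute continuity of piQ makes the second fact applicable
    by the first one.

    Fubini requires the flow to be measurable jointly in the point and the
    time.  At a fixed time measurability is read off the transition kernel of
    the process before its first jump ([measurable_flow_at]); right continuity
    of the orbits extends it to both variables ([measurable_alive]). *)

(** * Sets of zero n-dimensional Hausdorff content *)

Section HausdorffNull.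
Variable R : realType.
Implicit Types U V : normedModType R.

(** Covers by countably many balls.  A radius 0 gives an empty ball, which is how
    finite or partial families are padded; for this [0 ^+ n] has to vanish,
    whence the assumption [0 < n] in the lemmas below. *)
Definition hcover U (n : nat) (A : set U) (v : \bar R) : Prop :=
  exists (c : nat -> U) (r : nat -> R),
    [/\ forall m, 0 <= r m, A `<=` \bigcup_m ball (c m) (r m) &
        (\sum_(m <oo) (r m ^+ n)%:E <= v)%E].

(** Balls, rather than boxes, make the notion meaningful in every normed space
    and stable under maps that control distances from below. *)
Definition hnull U (n : nat) (A : set U) : Prop :=
  forall e : R, 0 < e -> hcover n A e%:E.

Lemma hcover_index U n (A : set U) v (I : countType) (c : I -> U) (r : I -> R) :
  (0 < n)%N -> (forall i, 0 <= r i) -> A `<=` \bigcup_i ball (c i) (r i) ->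
  (\esum_(i in [set: I]) (r i ^+ n)%:E <= v)%E -> hcover n A v.
Proof.
move=> n0 r0 Ac rv.
pose r' m := if @choice.pickle_inv I m is Some i then r i else 0.
pose c' m := if @choice.pickle_inv I m is Some i then c i else 0.
have r'0 m : 0 <= r' m by rewrite /r'; case: pickle_inv.
exists c', r'; split => //.
  move=> x /Ac[i _ xi]; exists (pickle i) => //.
  by rewrite /c' /r' pickleK_inv.
apply: le_trans rv; rewrite nneseries_esumT; last first.
  by move=> m; rewrite lee_fin exprn_ge0.
rewrite (_ : \esum_(i in _) _ = \esum_(i in range (@pickle I)) (r' i ^+ n)%:E)%E.
  rewrite (@reindex_esum _ _ _ [set: I] _ (@pickle I)).
    by apply: le_esum => i _; rewrite /r' pickleK_inv.
  split; [by move=> i _; exists i| |by move=> _ [i _ <-]; exists i].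
  by move=> i j _ _; exact: (pcan_inj (@pickleK I)).
rewrite [RHS]esum_mkcond; apply: eq_esum => m _.
case: ifPn => // /negP mr; rewrite /r'; case E : pickle_inv => [i|]; last first.
  by rewrite expr0n gtn_eqF.
exfalso; apply: mr; rewrite inE; exists i => //.
by have := @pickle_invK I m; rewrite E.
Qed.

Lemma hcover_bigcup U n (A : nat -> set U) (v : nat -> \bar R) :
  (0 < n)%N -> (forall m, hcover n (A m) (v m)) ->
  hcover n (\bigcup_m A m) (\sum_(m <oo) v m)%E.
Proof.
move=> n0 /choice[c] /choice[r] H.
have r0 k l : 0 <= r k l by have [] := H k.
apply: (@hcover_index _ _ _ _ (nat * nat)%type
  (fun k => c k.1 k.2) (fun k => r k.1 k.2)) => //.
  by move=> x [m _ Ax]; have [_ /(_ x Ax)[l _ xl] _] := H m; exists (m, l).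
rewrite (_ : [set: nat * nat] = [set: nat] `*`` (fun=> [set: nat])); last first.
  by apply/seteqP; split.
rewrite -(@esum_esum _ _ _ _ _ (fun k l => (r k l ^+ n)%:E)); last first.
  by move=> i j _ _; rewrite lee_fin exprn_ge0.
rewrite -nneseries_esumT; last first.
  by move=> m; apply: esum_ge0 => l _; rewrite lee_fin exprn_ge0.
apply: lee_nneseries => [m _ _|m _]; first by
  apply: esum_ge0 => l _; rewrite lee_fin exprn_ge0.
rewrite -nneseries_esumT; last by move=> l; rewrite lee_fin exprn_ge0.
by have [] := H m.
Qed.

Lemma hcover_sub U n (A B : set U) v w :
  A `<=` B -> (v <= w)%E -> hcover n B v -> hcover n A w.
Proof.
move=> AB vw [c [r [r0 Bc s]]]; exists c, r; split => //.
- exact: subset_trans AB Bc.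
- exact: le_trans vw.
Qed.

Lemma hnull_sub U n (A B : set U) : A `<=` B -> hnull n B -> hnull n A.
Proof. by move=> AB Bn e e0; apply: hcover_sub AB (lexx _) (Bn _ e0). Qed.

Lemma hnull_bigcup U n (A : nat -> set U) : (0 < n)%N ->
  (forall m, hnull n (A m)) -> hnull n (\bigcup_m A m).
Proof.
move=> n0 An e e0; have e2 m : 0 < e / (2 ^ m.+1)%:R.
  by rewrite divr_gt0// ltr0n expn_gt0.
exact: hcover_sub (@subset_refl _ _) (epsilon_trick0 xpredT (ltW e0))
  (hcover_bigcup n0 (fun m => An m _ (e2 m))).
Qed.

Lemma hnull_bigcup_count U n (I : countType) (A : I -> set U) : (0 < n)%N ->
  (forall i, hnull n (A i)) -> hnull n (\bigcup_i A i).
Proof.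
move=> n0 An.
apply: (@hnull_sub _ _ _
  (\bigcup_m (if @choice.pickle_inv I m is Some i then A i else set0))).
  by move=> x [i _ Ax]; exists (pickle i) => //; rewrite pickleK_inv.
apply: hnull_bigcup => // m; case: pickle_inv => [i|]; first exact: An.
move=> e e0; exists (fun=> 0), (fun=> 0); split => //.
by rewrite eseries0 ?lee_fin ?ltW// => i _ _; rewrite expr0n gtn_eqF.
Qed.

(** A piece of [E] that [f] sends into a ball of radius [r] has diameter at most
    [2 * K * r], hence lies in a ball of that radius around any of its points.
    The inequality is required on [E] only: it will hold on the pieces of
    countable decompositions, not globally. *)
Lemma hnull_expanding U V n (f : U -> V) (E : set U) (A : set V) (K : R) :
  0 < K -> (forall x y, E x -> E y -> `|x - y| <= K * `|f x - f y|) ->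
  hnull n A -> hnull n (E `&` f @^-1` A).
Proof.
move=> K0 fK An e e0.
have K2 : 0 < (2 * K) ^+ n by rewrite exprn_gt0// mulr_gt0.
have [c [r [r0 Ac rs]]] := An (e / (2 * K) ^+ n) (divr_gt0 e0 K2).
(* the new centres: a point of the m-th piece when there is one *)
have /choice[p pP] : forall m, exists p : U,
    (exists x, (E `&` f @^-1` ball (c m) (r m)) x) ->
    (E `&` f @^-1` ball (c m) (r m)) p.
  by move=> m; have [[x Hx]|nx] := pselect (exists x,
    (E `&` f @^-1` ball (c m) (r m)) x); [exists x|exists 0].
exists p, (fun m => 2 * K * r m); split.
- by move=> m; rewrite mulr_ge0// mulr_ge0// ltW.
- move=> x [Ex /Ac[m _ xm]]; exists m => //.
  have [|Ep] := pP m; first by exists x.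
  rewrite -!ball_normE /= => pm; rewrite -ball_normE /= in xm.
  apply: le_lt_trans (fK _ _ Ep Ex) _.
  rewrite (mulrC 2) -mulrA ltr_pM2l//.
  have -> : f (p m) - f x = (c m - f x) - (c m - f (p m)).
    by rewrite opprB [RHS]addrC subrKA.
  by apply: le_lt_trans (ler_normB _ _) _; rewrite mulr2n mulrDl mul1r ltrD.
- under eq_eseriesr do rewrite exprMn EFinM.
  rewrite nneseriesZl//; last by move=> m _; rewrite lee_fin exprn_ge0.
  apply: le_trans (lee_wpmul2l _ rs) _; first by rewrite lee_fin ltW.
  by rewrite -EFinM lee_fin mulrC divfK// gt_eqF.
Qed.

Lemma hnull_negligible (A : set R) : hnull 1 A ->
  (@lebesgue_measure R).-negligible A.
Proof.
move=> An.
have /choice[c] : forall k : nat, exists (cr : (nat -> R) * (nat -> R)),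
   [/\ forall m, 0 <= cr.2 m, A `<=` \bigcup_m ball (cr.1 m) (cr.2 m) &
        (\sum_(m <oo) (cr.2 m ^+ 1)%:E <= (k.+1%:R^-1)%:E)%E].
  by move=> k; have [|c [r H]] := An k.+1%:R^-1; [rewrite invr_gt0|exists (c, r)].
move=> cP.
pose B k := \bigcup_m (ball ((c k).1 m) ((c k).2 m) : set R).
have mB k : measurable (B k).
  by apply: bigcupT_measurable => m; exact: measurable_ball.
have mBB : measurable (\bigcap_k B k) by exact: bigcapT_measurable.
exists (\bigcap_k B k); split => //.
- apply/eqP; rewrite eq_le measure_ge0 andbT; apply/lee_addgt0Pr => e e0.
  rewrite add0e.
  have [k ke] : exists k : nat, 2 * k.+1%:R^-1 <= e.
    have [k _ /(_ k (leqnn k)) kP] := near_infty_natSinv_lt (PosNum (divr_gt0 e0 (ltr0n R 2))).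
    by exists k; rewrite -ler_pdivlMl// mulrC ltW.
  apply: (@le_trans _ _ (lebesgue_measure (B k))).
    apply: le_measure.
    - by rewrite inE.
    - by rewrite inE; exact: mB.
    - by move=> x /(_ k Logic.I).
  apply: (@le_trans _ _ (\sum_(m <oo) lebesgue_measure (ball ((c k).1 m) ((c k).2 m) : set R))%E).
    apply: (@measure_sigma_subadditive _ _ _ lebesgue_measure) => //.
    - by move=> m; exact: measurable_ball.
    - exact: mB.
  have [r0 _ rs] := cP k.
  apply: (@le_trans _ _ (\sum_(m <oo) (2%:E * ((c k).2 m ^+ 1)%:E))%E).
    apply: lee_nneseries => // m _.
    by rewrite lebesgue_measure_ball// -EFinM lee_fin expr1 mulr_natl.
  rewrite nneseriesZl//; last by move=> m _; rewrite lee_fin exprn_ge0.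
  apply: le_trans (lee_wpmul2l _ rs) _ => //.
- by move=> x Ax k _; have [_ /(_ x Ax)] := cP k.
Qed.

(** The volume of a box depends continuously on its sides; enlarging all of them
    makes a possibly flat box nondegenerate at an arbitrarily small cost. *)
Lemma prod_addr_le (I : finType) (l : I -> R) (eta : R) : 0 < eta ->
  exists2 e : R, 0 < e & \prod_i (l i + e) <= \prod_i l i + eta.
Proof.
move=> eta0; pose p : {poly R} := \prod_i ((l i)%:P + 'X).
have pE x : p.[x] = \prod_i (l i + x).
  by rewrite /p horner_prod; apply: eq_bigr => i _; rewrite !hornerE.
have /cvgrPdist_lt/(_ _ eta0) H := cvg_at_right_filter (@continuous_horner _ p 0).
 near (0 : R)^'+ => e.
exists e => //.
have : `|p.[0] - p.[e]| < eta by near: e.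
rewrite ltr_norml => /andP[+ _]; rewrite !pE.
by under eq_bigr do rewrite addr0; move=> ?; lra.
Unshelve. all: by end_near. Qed.

Lemma rV_coord_le n (x : 'rV[R]_n) j : `|x ord0 j| <= `|x|.
Proof.
rewrite [leRHS](mx_normrE x); exact: (le_bigmax _ (fun k => `|x k.1 k.2|) (ord0, j)).
Qed.

Lemma rV_norm_le n (x : 'rV[R]_n) e : 0 <= e ->
  (forall j, `|x ord0 j| <= e) -> `|x| <= e.
Proof.
move=> e0 H; rewrite [leLHS](mx_normrE x); apply: bigmax_le => // -[i j] _ /=.
by rewrite (ord1 i).
Qed.

Lemma rV_norm_lt n (x : 'rV[R]_n) e : 0 < e ->
  (forall j, `|x ord0 j| < e) -> `|x| < e.
Proof.
move=> e0 H; rewrite [ltLHS](mx_normrE x); apply: bigmax_lt => // -[i j] _ /=.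
by rewrite (ord1 i).
Qed.

(** After the sides of the box have been enlarged to positive lengths [L j], it
    is covered by cubes whose side [s] is the smallest of them.  Along the j-th
    axis at most [2 * L j / s] cubes are needed, since [s <= L j]: this is where
    the factor [2 ^+ n] comes from. *)
Lemma hcover_box n (a b : 'rV[R]_n) (eta : R) : (0 < n)%N ->
  (forall j, a ord0 j <= b ord0 j) -> 0 < eta ->
  hcover n [set x : 'rV[R]_n | forall j, a ord0 j <= x ord0 j <= b ord0 j]
    (2 ^+ n * (\prod_j (b ord0 j - a ord0 j) + eta))%:E.
Proof.
case: n a b => // n a b _ ab eta0.
have [e e0 eP] := prod_addr_le (fun j => b ord0 j - a ord0 j) eta0.
pose L j := b ord0 j - a ord0 j + e.
have L0 j : 0 < L j by rewrite /L ltr_wpDl// subr_ge0.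
pose s := \big[Num.min/L ord0]_j L j.
have s0 : 0 < s by rewrite /s lt_bigmin.
have sL j : s <= L j by rewrite /s; exact: bigmin_le.
pose N j := (Num.truncn (L j / s)).+1.
have NL j : (N j)%:R * s <= 2 * L j.
  rewrite /N -natr1 mulrDl mul1r.
  have : (Num.truncn (L j / s))%:R * s <= L j.
    by rewrite -ler_pdivlMr// truncn_le divr_ge0// ltW.
  by have := sL j; lra.
(* the grid is indexed by one finite type of functions bounded by the largest
   N j; indices outside the box get radius 0 *)
pose M := \max_j N j.
pose c (f : {ffun 'I_n.+1 -> 'I_M}) : 'rV[R]_n.+1 :=
  \row_j (a ord0 j + (f j)%:R * s).
pose r (f : {ffun 'I_n.+1 -> 'I_M}) : R :=
  if f \in family (fun j => [pred i : 'I_M | (i < N j)%N]) then s else 0.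
apply: (@hcover_index _ _ _ _ _ c r) => //.
- by move=> f; rewrite /r; case: ifP => // _; exact: ltW.
- move=> x xab; pose k j := Num.truncn ((x ord0 j - a ord0 j) / s).
  have kN j : (k j < N j)%N.
    rewrite ltnS; apply: le_truncn.
    rewrite ler_pM2r ?invr_gt0// /L.
    by have /andP[_] := xab j; have := e0; lra.
  have kM j : (k j < M)%N by apply: leq_trans (kN j) _; exact: leq_bigmax.
  exists [ffun j => Ordinal (kM j)] => //.
  rewrite /r ifT; last by apply/familyP => j; rewrite ffunE; exact: kN.
  rewrite -ball_normE /=; apply: rV_norm_lt => // j.
  rewrite !mxE ffunE /=.
  have y0 : 0 <= (x ord0 j - a ord0 j) / s.
    by apply: divr_ge0; [have /andP[] := xab j; rewrite subr_ge0|exact: ltW].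
  have /andP[] := truncn_itv y0.
  rewrite -/(k j) ler_pdivlMr// ltr_pdivrMr// -natr1 mulrDl mul1r => h1 h2.
  by rewrite ltr_norml; lra.
- have fT : finite_set [set: {ffun 'I_n.+1 -> 'I_M}] by exact: finite_finset.
  rewrite esum_fset//; last by move=> f _; rewrite lee_fin exprn_ge0// /r;
    case: ifP => // _; exact: ltW.
  rewrite (_ : [set: _] = [set` index_enum {ffun 'I_n.+1 -> 'I_M}]); last first.
    by apply/seteqP; split => // f _ /=; rewrite mem_index_enum.
  rewrite -fsbig_seq ?index_enum_uniq//= sumEFin lee_fin.
  apply: (@le_trans _ _ (2 ^+ n.+1 * \prod_j L j)); last first.
    by rewrite ler_wpM2l// exprn_ge0.
  rewrite (_ : \sum_f _ = \prod_j ((N j)%:R * s)).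
    rewrite -[leRHS](_ : \prod_j (2 * L j) = _); last first.
      by rewrite big_split/= prodr_const card_ord.
    by apply: ler_prod => j _; rewrite NL andbT mulr_ge0// ltW.
  transitivity (\prod_(j < n.+1) \sum_(i < M | (i < N j)%N) s).
    rewrite bigA_distr_big_dep/= [RHS]big_mkcond/=.
    apply: eq_bigr => f _; rewrite /r; case: ifP => _.
      by rewrite prodr_const card_ord.
    by rewrite expr0n.
  apply: eq_bigr => j _.
  have NM : (N j <= M)%N by exact: leq_bigmax.
  by rewrite -(big_ord_widen _ (fun=> s) NM) sumr_const card_ord mulr_natl.
Qed.

Lemma lebesgue_rV_hnull n (A : set 'rV[R]_n) : (0 < n)%N ->
  lebesgue_rV A = 0%E -> hnull n A.
Proof.
move=> n0 A0 e e0.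
have n20 : 0 < 2 ^+ n :> R by rewrite exprn_gt0.
pose e' := e / 2 ^+ n / 2.
have e'0 : 0 < e' by rewrite divr_gt0// divr_gt0.
have : (lebesgue_rV A < e'%:E)%E by rewrite A0 lte_fin.
move=> /ereal_inf_lt[_ [a [b [ab Aab ->]]] lt].
pose v m := \prod_j (b m ord0 j - a m ord0 j).
have v0 m : 0 <= v m by apply: prodr_ge0 => j _; rewrite subr_ge0.
have d0 m : 0 < e' / (2 ^ m.+1)%:R by rewrite divr_gt0// ltr0n expn_gt0.
have := hcover_bigcup n0 (fun m => hcover_box n0 (ab m) (d0 m)).
apply: hcover_sub => //.
under eq_eseriesr do rewrite EFinM.
rewrite nneseriesZl//; last by move=> m _; rewrite lee_fin;
  apply: addr_ge0; [exact: v0|exact/ltW/d0].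
rewrite -lee_pdivlMl// -EFinM mulrC.
rewrite (_ : e / _ = e' + e'); last by rewrite /e'; lra.
under eq_eseriesr do rewrite EFinD.
apply: le_trans (epsilon_trick _ _ (ltW e'0)) _ => //.
by rewrite EFinD leeD2r// ltW.
Qed.

Lemma hnull_lebesgue_rV n (A : set 'rV[R]_n) : (0 < n)%N ->
  hnull n A -> lebesgue_rV A = 0%E.
Proof.
move=> n0 An; apply/eqP; rewrite eq_le; apply/andP; split; last first.
  apply: le_ereal_inf_tmp => _ [a [b [ab _ ->]]].
  apply: nneseries_ge0 => m _ _; rewrite lee_fin.
  by apply: prodr_ge0 => j _; rewrite subr_ge0.
apply/lee_addgt0Pr => e e0; rewrite add0e.
have n20 : 0 < 2 ^+ n :> R by rewrite exprn_gt0.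
have [c [r [r0 Ac rs]]] := An (e / 2 ^+ n) (divr_gt0 e0 n20).
apply: (@le_trans _ _ (\sum_(m <oo) (2 ^+ n * r m ^+ n)%:E)%E).
  apply: ereal_inf_lbound.
  exists (fun m => \row_j (c m ord0 j - r m)), (fun m => \row_j (c m ord0 j + r m)).
  split.
  - by move=> m j; rewrite !mxE; have := r0 m; lra.
  - move=> x /Ac[m _]; rewrite -ball_normE /= => xm; exists m => // j.
    rewrite !mxE; have := le_lt_trans (rV_coord_le _ j) xm.
    by rewrite !mxE ltr_norml; lra.
  - apply: eq_eseriesr => m _; congr (_%:E).
    rewrite -exprMn -[RHS](_ : \prod_(j < n) (2 * r m) = _).
      by rewrite prodr_const card_ord.
    by apply: eq_bigr => j _; rewrite !mxE; ring.
under eq_eseriesr do rewrite EFinM.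
rewrite nneseriesZl//; last by move=> m _; rewrite lee_fin exprn_ge0.
by rewrite -lee_pdivlMl// -EFinM mulrC.
Qed.

End HausdorffNull.

(** * Orbits of a flow, also from an entrance point *)

Lemma is_derive_subr (R : realType) (V : normedModType R) (f : R -> V) (u a : R) df :
  is_derive (u - a) 1 f df -> is_derive u 1 (fun w => f (w - a)) df.
Proof.
have E : (fun h => h^-1 *: (((fun w => f (w - a)) \o shift u) (h *: 1) - f (u - a)))
    = (fun h => h^-1 *: ((f \o shift (u - a)) (h *: 1) - f (u - a))).
  by apply/funext => h /=; rewrite addrA.
by move=> [df1 df2]; split; [rewrite /derivable E|rewrite -df2 /derive E].
Qed.

Section Flow.
Variables (R : realType) (n : nat) (D : set 'rV[R]_n) (r : 'rV[R]_n -> 'rV[R]_n).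
Variable phi : 'rV[R]_n -> R -> 'rV[R]_n.
Hypotheses (oD : open D) (hf : is_flow D r phi).

(** At the infimum of the times at which the orbit is outside [D] the orbit is
    itself outside: if it were in [D], it would be differentiable there, hence
    in the open set [D] for a little longer. *)
Lemma flow_first_exit x s : D x -> 0 <= s ->
  (forall u, 0 <= u <= s -> D (phi x u)) \/
  exists e, [/\ 0 < e, e <= s, forall u, 0 <= u < e -> D (phi x u) &
                ~ D (phi x e)].
Proof.
move=> Dx s0.
have [|/existsNP[u0 /not_implyP[/andP[u00 u0s] nu0]]] :=
  pselect (forall u, 0 <= u <= s -> D (phi x u)); first by left.
right; pose S := [set u | 0 <= u <= s /\ ~ D (phi x u)].
have hS : has_inf S.
  split; first by exists u0; split => //; apply/andP.
  by exists 0 => u [/andP[]].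
pose e := inf S.
have e0 : 0 <= e by apply: lb_le_inf; [case: hS|move=> u [/andP[]]].
have geS u : S u -> e <= u by move=> Su; apply: ge_inf => //; case: hS.
have es : e <= s.
  by apply: (le_trans (geS _ _) u0s); split => //; apply/andP.
have De u : 0 <= u < e -> D (phi x u).
  move=> /andP[u0' ue]; apply: contrapT => nu.
  have : e <= u.
    by apply: geS; split => //; rewrite u0' (le_trans (ltW ue)).
  by rewrite leNgt ue.
have nDe : ~ D (phi x e).
  move=> Dpe.
  have ce : {for e, continuous (phi x)}.
    apply: differentiable_continuous; apply/derivable1_diffP.
    have [] // := flow_ode hf (t := e) Dx.
    move=> u /orP[/andP[u0' ]|/andP[eu u0']].
      by rewrite le_eqVlt => /predU1P[->//|ue]; apply: De; rewrite u0'.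
    by have -> : u = e by apply/eqP; rewrite eq_le (le_trans u0').
  have : \forall w \near e, D (phi x w) by apply: ce; exact: open_nbhs_nbhs.
  move=> [d /= d0 Hd].
  have [w Sw we] := inf_adherent d0 hS.
  case: (Sw) => _; apply; apply: Hd => /=; rewrite -/e in we.
  rewrite distrC ger0_norm; first by rewrite ltrBlDl.
  by rewrite subr_ge0; exact: geS.
exists e; split => //; rewrite lt_neqAle e0 andbT; apply/eqP => e0'.
by apply: nDe; rewrite -e0' (flow0 hf).
Qed.

Lemma flow_exit_closure x e : D x -> 0 < e ->
  (forall u, 0 <= u < e -> D (phi x u)) -> closure D (phi x e).
Proof.
move=> Dx e0 De B nB.
have c := flow_exit hf Dx e0 De.
have : \forall s \near e^'-, B (phi x s) by exact: c.
have : \forall s \near e^'-, D (phi x s).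
  near=> s; apply: De; apply/andP; split => //.
  by near: s; apply: nbhs_left_ge.
move=> H1 H2.
have [s [Ds Bs]] : exists s, D (phi x s) /\ B (phi x s).
  exact: (@filter_ex _ e^'- _ _ (filterI H1 H2)).
by exists (phi x s).
Unshelve. all: by end_near. Qed.

(** Orbits that start at an entrance point are only known through the orbit of
    an inner point [x] that enters there at time [- a].  Treating an inner point
    as its own origin, with [a = 0], gives one description for both cases. *)
Definition orbit_origin y x a := [/\ D x, 0 <= a,
  forall v, - a < v <= 0 -> D (phi x v) &
  forall u, 0 <= u -> (forall s, 0 <= s < u - a -> D (phi x s)) ->
    phi y u = phi x (u - a)].

Lemma orbit_origin_inner y : D y -> orbit_origin y y 0.
Proof.
move=> Dy; split => //; last by move=> u _ _; rewrite subr0.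
by move=> v; rewrite oppr0 lt_le_asym.
Qed.

Lemma orbit_origin_entrance x t : D x -> 0 < t ->
  (forall s, 0 <= s < t -> D (phi x (- s))) -> ~ D (phi x (- t)) ->
  orbit_origin (phi x (- t)) x t.
Proof.
move=> Dx t0 Ds nD.
have Dv v : - t < v <= 0 -> D (phi x v).
  move=> /andP[tv v0]; rewrite -(opprK v); apply: Ds.
  by rewrite oppr_ge0 v0 ltrNl.
split => //; first exact: ltW.
move=> u u0 H; rewrite (flow_from_entrance hf) ?oppr_lt0// addrC//.
Qed.

Lemma orbit_inner y x a t : orbit_origin y x a ->
  (forall w, 0 < w < t -> D (phi y w)) ->
  forall v, (- a < v) || (0 <= v) -> v < t - a -> D (phi x v).
Proof.
move=> [Dx a0 Da H] Hw v av vt.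
have [v0|v0] := leP v 0.
  case/orP: av => [av|v0']; first by apply: Da; rewrite av.
  by rewrite (_ : v = 0) ?(flow0 hf)//; apply/eqP; rewrite eq_le v0.
have [|[e [e0 ev De nD]]] := flow_first_exit Dx (ltW v0).
  by apply; rewrite lexx ltW.
case: nD; rewrite -[e in phi x e](addrK a) -H; last 2 first.
- by rewrite addr_ge0// ltW.
- by move=> s; rewrite addrK; exact: De.
by apply: Hw; apply/andP; split; lra.
Qed.

Lemma orbit_shift y x a t : orbit_origin y x a ->
  (forall w, 0 < w < t -> D (phi y w)) ->
  forall u, 0 <= u <= t -> phi y u = phi x (u - a).
Proof.
move=> oy Hw u /andP[u0 ut]; have [Dx a0 Da H] := oy.
apply: H => // s /andP[s0 su]; apply: (orbit_inner oy Hw); first by rewrite s0 orbT.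
by apply: lt_le_trans su _; rewrite lerD2r.
Qed.

Lemma orbit_derive y x a t u : orbit_origin y x a ->
  (forall w, 0 < w < t -> D (phi y w)) -> 0 < u < t ->
  is_derive u 1 (phi y) (r (phi y u)).
Proof.
move=> oy Hw /andP[u0 ut]; have [Dx a0 Da H] := oy.
have S := orbit_shift oy Hw.
rewrite S ?u0 ?ltW//.
have dx : is_derive (u - a) 1 (phi x) (r (phi x (u - a))).
  apply: (flow_ode hf) => // s /orP[/andP[s0 su]|/andP[us s0]].
    apply: (orbit_inner oy Hw); first by rewrite s0 orbT.
    by apply: (le_lt_trans su); rewrite ltrD2r.
  by apply: Da; rewrite s0 andbT (lt_le_trans _ us)// ltrBDr addNr.
have ds := is_derive_subr dx.
apply: (near_eq_is_derive _ ds).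
have : \forall w \near u, w \in `]0, t[ by apply: near_in_itvoo; rewrite in_itv/= u0.
apply: filterS => w; rewrite in_itv/= => /andP[w0 wt].
by apply/esym/S; rewrite !ltW.
Qed.

Lemma orbit_cvg_right0 y x a t : orbit_origin y x a -> phi y 0 = y -> 0 < t ->
  (a = 0 \/ phi x s @[s --> (- a)^'+] --> phi x (- a)) ->
  (forall w, 0 < w < t -> D (phi y w)) ->
  phi y w @[w --> 0^'+] --> phi y 0.
Proof.
move=> oy y0 t0 ca Hw; have [Dx a0 Da H] := oy.
have S := orbit_shift oy Hw.
rewrite (S 0) ?lexx ?ltW// sub0r.
have cx : phi x s @[s --> (- a)^'+] --> phi x (- a).
  case: ca => // a00; rewrite a00 oppr0; apply: cvg_at_right_filter.
  apply: differentiable_continuous; apply/derivable1_diffP.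
  have [] // := flow_ode hf (t := 0) Dx.
  by move=> u; rewrite orbb => /le_anti <-; rewrite (flow0 hf).
apply/cvgrPdist_lt => e e0.
have /cvgrPdist_lt/(_ e e0)[dl /= dl0 Hd] := cx.
exists (Num.min dl t); first by rewrite /= lt_min dl0.
move=> w /=; rewrite sub0r normrN => wd w0; rewrite gtr0_norm// in wd.
have [wdl wt] : w < dl /\ w < t by move: wd; rewrite lt_min => /andP.
rewrite S ?(ltW w0) ?(ltW wt)//; apply: Hd => /=.
  by rewrite opprB addKr normrN gtr0_norm.
by rewrite ltrBDr addNr.
Qed.

End Flow.

(** * Gronwall's inequality backwards in time *)

Section Gronwall.
Variable R : realType.

Lemma rV_norm_sqr_le n (x : 'rV[R]_n) : `|x| ^+ 2 <= \sum_j (x ord0 j) ^+ 2.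
Proof.
have [->|x0] := eqVneq (`|x|) 0; first by rewrite expr0n sumr_ge0// => j _; exact: sqr_ge0.
have [[i j] /= xij] := mx_norm_neq0 x0.
rewrite (_ : `|x| = `|x i j|)// (ord1 i) real_normK ?num_real//.
by rewrite (bigD1 j)//= lerDl sumr_ge0// => k _; exact: sqr_ge0.
Qed.

Lemma is_derive_coord n (g : R -> 'rV[R]_n) (s : R) df j :
  is_derive s 1 g df -> is_derive s 1 (fun t => g t ord0 j) (df ord0 j).
Proof.
move=> [dg <-].
have H : (h^-1 *: (((fun t => g t ord0 j) \o shift s) (h *: 1) - g s ord0 j)
     @[h --> 0^'] --> ('D_1 g s) ord0 j).
  rewrite (_ : (fun h => _) = (fun M : 'rV[R]_n => M ord0 j) \o
     (fun h => h^-1 *: ((g \o shift s) (h *: 1) - g s))); last first.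
    by apply/funext => h /=; rewrite !mxE.
  exact: (continuous_cvg _ (@coord_continuous _ _ _ ord0 j _) dg).
by split; [apply/cvg_ex; eexists; exact: H|apply: cvg_lim H].
Qed.

(** The Euclidean square [h] of [g] satisfies [h' >= - c * h] with
    [c = 2 * n * L], so that [h s * expR (c * s)] is nondecreasing.  The
    dimensional constants come from comparing the sup norm, in which the
    hypothesis and the conclusion are stated, with the Euclidean one, which is
    differentiable. *)
Lemma gronwall_backward n (g dg : R -> 'rV[R]_n) (u L : R) : 0 <= u -> 0 <= L ->
  (forall s, 0 <= s <= u -> is_derive s 1 g (dg s)) ->
  (forall s, 0 <= s <= u -> `|dg s| <= L * `|g s|) ->
  `|g 0| <= n.+1%:R * expR (n%:R * L * u) * `|g u|.
Proof.
move=> u0 L0 Hd HL.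
pose h s := \sum_(j < n) (g s ord0 j) ^+ 2.
pose dh s := \sum_(j < n) (2 * g s ord0 j * dg s ord0 j).
pose c := 2 * n%:R * L.
pose F s := h s * expR (c * s).
have dhs s : 0 <= s <= u -> is_derive s 1 h (dh s).
  move=> su; rewrite (_ : h = \sum_(j < n) (fun t => (g t ord0 j) ^+ 2)); last first.
    by apply/funext => t; rewrite fct_sumE.
  apply: is_derive_sum => j.
  have dj := is_derive_coord j (Hd s su).
  rewrite (_ : (fun t => _) =
    (fun t => g t ord0 j) * (fun t => g t ord0 j)); last by apply/funext => t.
  apply: (is_derive_eq (is_deriveM dj dj)).
  by rewrite /GRing.scale/=; ring.
have dF s : 0 <= s <= u -> is_derive s 1 F (dh s * expR (c * s) + h s * (c * expR (c * s))).
  move=> su.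
  have de : is_derive s 1 (fun t => expR (c * t)) (expR (c * s) * c).
    have dc : is_derive s 1 (fun t : R => c * t) c.
      rewrite (_ : (fun t => _) = c \*: (id : R -> R))//.
      by apply: is_derive_eq; rewrite /GRing.scale/= mulr1.
    exact: (is_derive1_comp (g := fun t => c * t) (is_derive_expR _) dc).
  rewrite (_ : F = h * (fun t => expR (c * t)))//.
  apply: (is_derive_eq (is_deriveM (dhs s su) de)).
  by rewrite /GRing.scale/=; ring.
have dF0 s : 0 <= s <= u -> 0 <= dh s * expR (c * s) + h s * (c * expR (c * s)).
  move=> su; rewrite mulrA -mulrDl mulr_ge0 ?expR_ge0//.
  suff : - (c * h s) <= dh s by lra.
  have dj j : - (2 * (L * `|g s| ^+ 2)) <= 2 * g s ord0 j * dg s ord0 j.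
    have : `|g s ord0 j * dg s ord0 j| <= L * `|g s| ^+ 2.
      rewrite normrM (mulrC L) expr2 -mulrA.
      apply: ler_pM => //; first exact: rV_coord_le.
      by rewrite mulrC; apply: le_trans (rV_coord_le _ _) (HL _ su).
    by rewrite ler_norml => /andP[+ _]; rewrite -mulrA; lra.
  apply: (@le_trans _ _ (\sum_(j < n) - (2 * (L * `|g s| ^+ 2)))).
    rewrite sumr_const card_ord -[leRHS]mulr_natl mulrN lerN2 /c.
    rewrite -!mulrA (mulrCA n%:R 2) ler_pM2l// ler_wpM2l// ler_wpM2l//.
    exact: rV_norm_sqr_le.
  by apply: ler_sum => j _.
have F0u : F 0 <= F u.
  have [->//|un0] := eqVneq u 0.
  apply: (@ger0_derive1_le_cc _ F 0 u); rewrite ?in_itv/= ?lexx ?u0//.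
  - move=> s; rewrite in_itv/= => /andP[s0 su].
    by have [] := dF s; rewrite ?ltW.
  - move=> s; rewrite in_itv/= => /andP[s0 su]; rewrite derive1E.
    by have [|_ ->] := dF s; rewrite ?dF0 ?ltW.
  - apply: derivable_within_continuous => s; rewrite in_itv/= => su.
    by have [] := dF s su.
have F0E : F 0 = h 0 by rewrite /F mulr0 expR0 mulr1.
have hu : h u <= n%:R * `|g u| ^+ 2.
  have -> : n%:R * `|g u| ^+ 2 = \sum_(j < n) `|g u| ^+ 2.
    by rewrite sumr_const card_ord mulr_natl.
  apply: ler_sum => j _.
  by rewrite -[leLHS]real_normK ?num_real// ler_sqr ?nnegrE// rV_coord_le.
have K0 : 0 <= n.+1%:R * expR (n%:R * L * u) * `|g u|.
  by rewrite !mulr_ge0// expR_ge0.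
apply: rV_norm_le => // j.
rewrite -ler_sqr ?nnegrE// real_normK ?num_real//.
apply: (@le_trans _ _ (h 0)).
  by rewrite /h (bigD1 j)//= lerDl sumr_ge0// => k _; exact: sqr_ge0.
rewrite -F0E; apply: (le_trans F0u); rewrite /F.
apply: (@le_trans _ _ (n%:R * `|g u| ^+ 2 * expR (c * u))).
  by rewrite ler_wpM2r// expR_ge0.
have -> : expR (c * u) = expR (n%:R * L * u) ^+ 2.
  by rewrite -expRM_natl; congr expR; rewrite /c; ring.
rewrite exprMn exprMn mulrAC ler_wpM2r ?sqr_ge0// ler_wpM2r ?sqr_ge0//.
rewrite -natrX ler_nat expnS expn1 mulSn; apply: leq_trans (leqnSn n) _.
exact: leq_addr.
Qed.

End Gronwall.

(** * Maps that pull null sets back to null sets *)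

Section Cells.
Variables (R : realType) (n : nat).

Lemma floor_lt m (x y : R) :
  Num.floor (m.+1%:R * x) = Num.floor (m.+1%:R * y) -> `|x - y| < m.+1%:R^-1.
Proof.
move=> xy; have m0 : 0 < m.+1%:R :> R by [].
rewrite -(ltr_pM2l m0) divff ?gt_eqF// -[X in X * _](gtr0_norm m0) -normrM mulrBr.
have /andP[a1 a2] := floor_itv (m.+1%:R * x).
have /andP[b1 b2] := floor_itv (m.+1%:R * y).
rewrite xy in a1 a2; rewrite intrD in a2 b2.
by rewrite ltr_norml; apply/andP; split; lra.
Qed.

(** A countable index for sets of diameter less than [1 / m.+1]. *)
Definition cell (m : nat) (x : 'rV[R]_n) : 'rV[int]_n :=
  \row_j Num.floor (m.+1%:R * x ord0 j).

Lemma cell_lt m (x y : 'rV[R]_n) : cell m x = cell m y -> `|x - y| < m.+1%:R^-1.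
Proof.
move=> xy; apply: rV_norm_lt => [|j]; first by rewrite invr_gt0.
by have /rowP/(_ j) := xy; rewrite !mxE; exact: floor_lt.
Qed.

End Cells.

Section DerivNeq0.
Variables (R : realType).

Lemma derive_neq0_expanding (V : normedModType R) (g : R -> V) (u : R) df :
  df != 0 -> is_derive u 1 g df ->
  exists m : nat, forall w, `|w - u| < m.+1%:R^-1 -> `|w - u| <= m.+1%:R * `|g w - g u|.
Proof.
move=> df0 [dg dE].
have n0 : 0 < `|df| by rewrite normr_gt0.
have n02 : 0 < `|df| / 2 by rewrite divr_gt0.
have dg' : (h^-1 *: ((g \o shift u) (h *: 1) - g u) @[h --> 0^'] --> df).
  by rewrite -dE.
have /cvgrPdist_lt/(_ _ n02)[d /= d0 Hd] := dg'.
have M0 : 0 < Num.min d (`|df| / 2) by rewrite lt_min d0.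
have [m _ /(_ m (leqnn m)) mM] := near_infty_natSinv_lt (PosNum M0).
rewrite /= lt_min in mM; case/andP: mM => md mf.
exists m => w wm; have [->|wu] := eqVneq w u; first by rewrite !subrr !normr0 mulr0.
have wu0 : w - u != 0 by rewrite subr_eq0.
have := Hd (w - u); rewrite /= sub0r normrN => /(_ (lt_trans wm md) wu0).
rewrite /GRing.scale /= mulr1 subrK => H.
have : `|df| / 2 <= `|(w - u)^-1 *: (g w - g u)|.
  by have := lerB_dist df ((w - u)^-1 *: (g w - g u)); lra.
rewrite normrZ normfV ler_pdivlMl ?normr_gt0// => H2.
rewrite -ler_pdivrMl//; apply: le_trans H2.
rewrite mulrC ler_wpM2l//; exact: ltW.
Qed.

(** The scale on which the expansion of [derive_neq0_expanding] holds depends on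
    the point.  Sorting the points by this scale and by a cell of smaller
    diameter leaves countably many sets on each of which it is uniform. *)
Lemma derive_neq0_hnull n (g : R -> 'rV[R]_n) (E : set R) (A : set 'rV[R]_n) :
  (0 < n)%N ->
  (forall u, E u -> exists2 df, df != 0 & is_derive u 1 g df) ->
  hnull n A -> hnull n (E `&` g @^-1` A).
Proof.
move=> n0 HE An.
pose P m (z : int) := [set u | [/\ E u, Num.floor (m.+1%:R * u) = z &
  forall w, `|w - u| < m.+1%:R^-1 -> `|w - u| <= m.+1%:R * `|g w - g u| ]].
apply: (@hnull_sub _ _ _ _ (\bigcup_(p : nat * int) (P p.1 p.2 `&` g @^-1` A))).
  move=> u [Eu Au]; have [df df0 /(derive_neq0_expanding df0)[m Hm]] := HE u Eu.
  by exists (m, Num.floor (m.+1%:R * u)).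
apply: hnull_bigcup_count => // -[m z] /=.
apply: (hnull_expanding (K := m.+1%:R)) => // x y [Ex zx Hx] [Ey zy Hy].
rewrite distrC (distrC (g x)); apply: Hx.
by apply: floor_lt; rewrite zx zy.
Qed.

End DerivNeq0.

Section FlowNull.
Variables (R : realType) (n : nat) (D : set 'rV[R]_n) (r : 'rV[R]_n -> 'rV[R]_n).
Variable phi : 'rV[R]_n -> R -> 'rV[R]_n.
Hypotheses (oD : open D) (hf : is_flow D r phi).
Hypothesis lip : [locally [lipschitz (r x) | x in D]].

(** The local Lipschitz condition near [(p, p)], with the neighbourhood made
    into a ball. *)
Lemma lip_at p : D p -> exists M d : R, [/\ 0 < M, 0 < d &
  forall a b, D a -> D b -> `|a - p| < d -> `|b - p| < d -> `|r a - r b| <= M * `|a - b|].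
Proof.
move=> Dp; have /= [M [_ HM]] := lip (x := (p, p)) (conj Dp Dp).
pose M' := Num.max M 0 + 1.
have M'M : M < M' by rewrite /M' ltr_pwDr// le_max lexx.
have := HM M' M'M; rewrite /dominated_by /within /= => -[[A B] [/= nA nB] AB].
have [d1 /= d10 Hd1] := (nbhs_ballP _ _).1 nA.
have [d2 /= d20 Hd2] := (nbhs_ballP _ _).1 nB.
exists M', (Num.min d1 d2); split.
- by rewrite /M' ltr_wpDl// le_max lexx orbT.
- by rewrite lt_min d10.
- move=> a b Da Db; rewrite !lt_min => /andP[a1 a2] /andP[b1 b2].
  apply: (AB (a, b)) => //; split => /=.
    by apply: Hd1; rewrite -ball_normE /= distrC.
  by apply: Hd2; rewrite -ball_normE /= distrC.
Qed.

Definition survivors u : set 'rV[R]_n :=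
  [set y | D y /\ forall s, 0 <= s <= u -> D (phi y s)].

Lemma survivor_derive u y s : survivors u y -> 0 <= s <= u ->
  is_derive s 1 (phi y) (r (phi y s)).
Proof.
move=> [Dy Ds] /andP[s0 su]; apply: (flow_ode hf) => // w /orP[/andP[w0 ws]|/andP[sw w0]].
  by apply: Ds; rewrite w0 (le_trans ws).
by rewrite (_ : w = 0) ?(flow0 hf)//; apply/eqP; rewrite eq_le w0 (le_trans s0).
Qed.

Lemma survivor_continuous u y s : survivors u y -> 0 <= s <= u ->
  {for s, continuous (phi y)}.
Proof.
move=> sy su; apply: differentiable_continuous; apply/derivable1_diffP.
by have [] := survivor_derive sy su.
Qed.

(** The orbit up to time [u] is compact, so that finitely many of the local
    Lipschitz constants suffice near it.  One integer serves both as constant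
    and as inverse width of the neighbourhood.  The numerator 3 is the number of
    steps in the triangle inequality of [piece_close]. *)
Lemma survivor_lip u y : survivors u y -> exists m : nat,
  forall s, 0 <= s <= u -> forall a, D a -> `|a - phi y s| < 3 / m.+1%:R ->
    `|r a - r (phi y s)| <= m.+1%:R * `|a - phi y s|.
Proof.
move=> sy; have [Dy Ds] := sy.
have /compact_near_coveringP cov := @segment_compact R 0 u.
have : \forall m \near \oo, `[0, u] `<=` (fun s => forall a, D a ->
   `|a - phi y s| < 3 / m.+1%:R -> `|r a - r (phi y s)| <= m.+1%:R * `|a - phi y s|).
  apply: cov => s0; rewrite /= in_itv/= => s0u.
  have [M [e [M0 e0 He]]] := lip_at (Ds _ s0u).
  have e2 : 0 < e / 2 by rewrite divr_gt0.
  have e6 : 0 < e / 6 by rewrite divr_gt0.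
  have /cvgrPdist_lt/(_ _ e2) Hc := survivor_continuous sy s0u.
  near=> s m => /= a Da am.
  have sp : `|phi y s0 - phi y s| < e / 2 by near: s.
  have m6 : m.+1%:R^-1 < e / 6 by near: m; exact: (near_infty_natSinv_lt (PosNum e6)).
  have mM : M <= m.+1%:R.
    near: m; exists (Num.truncn M) => // k /= Mk.
    by apply: ltW; apply: (lt_le_trans (truncnS_gt M)); rewrite ler_nat.
  have Dps : D (phi y s).
    by near: s; apply: (survivor_continuous sy s0u); apply: open_nbhs_nbhs; split => //; exact: Ds.
  have ae : `|a - phi y s0| < e.
    rewrite -(subrKA (phi y s)); apply: le_lt_trans (ler_normD _ _) _.
    rewrite (distrC (phi y s)); move: am sp m6; set i := m.+1%:R^-1 => am sp m6.
    by lra.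
  have se : `|phi y s - phi y s0| < e by rewrite distrC; lra.
  apply: le_trans (He _ _ Da Dps ae se) _.
  by rewrite ler_wpM2r.
by move=> [m _ /(_ m (leqnn m)) Hm]; exists m => s su; apply: Hm; rewrite /= in_itv.
Unshelve. all: by end_near. Qed.

Lemma survivor_unif u y e : survivors u y -> 0 < e -> exists N : nat,
  forall s s', 0 <= s <= u -> 0 <= s' <= u -> `|s - s'| <= N.+1%:R^-1 ->
    `|phi y s - phi y s'| < e.
Proof.
move=> sy e0.
have /compact_near_coveringP cov := @segment_compact R 0 u.
have : \forall N \near \oo, `[0, u] `<=` (fun s => forall s', 0 <= s' <= u ->
   `|s - s'| <= N.+1%:R^-1 -> `|phi y s - phi y s'| < e).
  apply: cov => s0; rewrite /= in_itv/= => s0u.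
  have e2 : 0 < e / 2 by rewrite divr_gt0.
  have /cvgrPdist_lt/(_ _ e2)[d /= d0 Hd] := survivor_continuous sy s0u.
  have d2 : 0 < d / 2 by rewrite divr_gt0.
  near=> s N => /= s' s'u ss'.
  have s0s : `|s0 - s| < d / 2 by near: s; exists (d / 2).
  have N2 : N.+1%:R^-1 < d / 2 by near: N; exact: (near_infty_natSinv_lt (PosNum d2)).
  have ss2 := le_lt_trans ss' N2.
  have h1 : `|phi y s0 - phi y s| < e / 2.
    by apply: Hd => /=; apply: (lt_trans s0s); lra.
  have h2 : `|phi y s0 - phi y s'| < e / 2.
    apply: Hd => /=; rewrite -(subrKA s).
    by apply: le_lt_trans (ler_normD _ _) _; lra.
  rewrite distrC in h1; rewrite -(subrKA (phi y s0)).
  by apply: le_lt_trans (ler_normD _ _) _; lra.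
move=> [N _ /(_ N (leqnn N)) HN]; exists N => s s' su; apply: HN.
by rewrite /= in_itv.
Unshelve. all: by end_near. Qed.

(** The points that share the constants [m] of [survivor_lip] and [N] of
    [survivor_unif], and whose orbits pass through the same cells [z] at the
    multiples of [1 / N.+1].  The index set is countable. *)
Definition piece u (p : nat * nat * seq 'rV[int]_n) : set 'rV[R]_n :=
  let: (m, N, z) := p in [set y | [/\ survivors u y,
    forall s, 0 <= s <= u -> forall a, D a -> `|a - phi y s| < 3 / m.+1%:R ->
      `|r a - r (phi y s)| <= m.+1%:R * `|a - phi y s|,
    forall s s', 0 <= s <= u -> 0 <= s' <= u -> `|s - s'| <= N.+1%:R^-1 ->
      `|phi y s - phi y s'| < m.+1%:R^-1 &
    z = [seq cell m (phi y (k%:R / N.+1%:R)) |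
          k <- iota 0 (Num.truncn (u * N.+1%:R)).+1] ]].

(** Go from one orbit to the other at the last multiple [t] of [1 / N.+1] before
    [s], where both are in the same cell. *)
Lemma piece_close u m N z x y s : piece u (m, N, z) x -> piece u (m, N, z) y ->
  0 <= s <= u -> `|phi x s - phi y s| < 3 / m.+1%:R.
Proof.
move=> [_ _ Ux zx] [_ _ Uy zy] su; have /andP[s0 su'] := su.
have N0 : 0 < N.+1%:R :> R by [].
pose k := Num.truncn (s * N.+1%:R); pose t : R := k%:R / N.+1%:R.
have sN0 : 0 <= s * N.+1%:R by rewrite mulr_ge0.
have /andP[k1 k2] := truncn_itv sN0.
have ts : t <= s by rewrite ler_pdivrMr.
have st : s - t <= N.+1%:R^-1.
  rewrite lerBlDr -[N.+1%:R^-1]mul1r -mulrDl ler_pdivlMr// ltW//.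
  by rewrite addrC natr1.
have tu : 0 <= t <= u by rewrite divr_ge0//= (le_trans ts).
have kN : (k < (Num.truncn (u * N.+1%:R)).+1)%N.
  by rewrite ltnS; apply: le_truncn; rewrite ler_wpM2r.
have : cell m (phi x t) = cell m (phi y t).
  have : nth 0 z k = nth 0 z k by [].
  rewrite {1}zx zy !(nth_map 0%N) ?size_iota// nth_iota//.
move=> /cell_lt xyt.
have d1 : `|phi x s - phi x t| < m.+1%:R^-1 by apply: Ux => //; rewrite ger0_norm ?subr_ge0.
have d2 : `|phi y t - phi y s| < m.+1%:R^-1.
  by apply: Uy => //; rewrite distrC ger0_norm ?subr_ge0.
have -> : phi x s - phi y s =
  (phi x s - phi x t) + (phi x t - phi y t) + (phi y t - phi y s).
  by rewrite subrKA subrKA.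
apply: le_lt_trans (ler_normD _ _) _.
apply: le_lt_trans (lerD (ler_normD _ _) (lexx _)) _.
move: xyt d1 d2; set i := _^-1 => xyt d1 d2.
by rewrite (_ : 3 * i = i + i + i) ?ltrD//; ring.
Qed.

Lemma piece_expanding u m N z x y : 0 <= u ->
  piece u (m, N, z) x -> piece u (m, N, z) y ->
  `|x - y| <= n.+1%:R * expR (n%:R * m.+1%:R * u) * `|phi x u - phi y u|.
Proof.
move=> u0 px py; have [sx _ _ _] := px; have [sy Ly _ _] := py.
have [[Dx Dxs] [Dy Dys]] := (sx, sy).
rewrite -{1}(flow0 hf Dx) -{1}(flow0 hf Dy).
apply: (@gronwall_backward _ _ (fun s => phi x s - phi y s)
  (fun s => r (phi x s) - r (phi y s))) => //.
- move=> s su; have dx := survivor_derive sx su; have dy := survivor_derive sy su.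
  exact: (is_deriveB dx dy).
- move=> s su; apply: Ly => //; first exact: Dxs.
  exact: (piece_close px py su).
Qed.

(** The difference of two orbits of the same piece satisfies the hypotheses of
    Gronwall's inequality, which bounds the contraction by the flow at time
    [u] on each piece. *)
Lemma flow_preimage_hnull u (A : set 'rV[R]_n) : (0 < n)%N -> 0 <= u ->
  hnull n A -> hnull n (survivors u `&` (phi ^~ u) @^-1` A).
Proof.
move=> n0 u0 An.
apply: (@hnull_sub _ _ _ _ (\bigcup_p (piece u p `&` (phi ^~ u) @^-1` A))).
  move=> y [sy Ay]; have [m Hm] := survivor_lip sy.
  have m0 : 0 < m.+1%:R^-1 :> R by rewrite invr_gt0.
  have [N HN] := survivor_unif sy m0.
  by exists (m, N, [seq cell m (phi y (k%:R / N.+1%:R)) |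
          k <- iota 0 (Num.truncn (u * N.+1%:R)).+1]).
apply: hnull_bigcup_count => // -[[m N] z].
apply: (hnull_expanding (K := n.+1%:R * expR (n%:R * m.+1%:R * u))) => //.
  by rewrite mulr_gt0// expR_gt0.
by move=> x y; exact: piece_expanding.
Qed.

End FlowNull.

(** * Mixtures, image laws and null sections *)

Section Mixture.
Context d d' (X : measurableType d) (Y : measurableType d') (R : realType).
Variables (mu : {measure set X -> \bar R}) (k : R.-pker X ~> Y).

Definition mixture (A : set Y) : \bar R := (\int[mu]_x k x A)%E.

Let mixture0 : mixture set0 = 0%E.
Proof. by rewrite /mixture integral0_eq// => x _; rewrite measure0. Qed.

Let mixture_ge0 A : (0 <= mixture A)%E.
Proof. by apply: integral_ge0 => x _; exact: measure_ge0. Qed.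

Let mixture_sigma_additive : semi_sigma_additive mixture.
Proof.
move=> F mF tF mUF.
rewrite [X in _ --> X](_ : _ = \sum_(n <oo) mixture (F n))%E.
  by apply/cvg_closeP; split; [exact: is_cvg_nneseries|rewrite closeE].
rewrite -integral_nneseries//; last by move=> n; exact: measurable_kernel.
apply: eq_integral => x _; apply/esym/cvg_lim => //.
exact: measure_semi_sigma_additive.
Qed.

HB.instance Definition _ := isMeasure.Build _ _ _ mixture
  mixture0 mixture_ge0 mixture_sigma_additive.

Definition mixture_measure : {measure set Y -> \bar R} := mixture.

Lemma mixture_setT : mu setT = 1%E -> mixture_measure setT = 1%E.
Proof.
move=> mu1; rewrite /mixture_measure /= /mixture (eq_integral (cst 1%E)).
  by rewrite integral_cst// mul1e.
by move=> x _; exact: prob_kernel.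
Qed.

Lemma mixture_eq0 (A : set Y) : measurable A ->
  mixture_measure A = 0%E <-> \forall x \ae mu, k x A = 0%E.
Proof.
move=> mA; have mk : measurable_fun setT (k ^~ A) by exact: measurable_kernel.
have := ae_eq_integral_abs mu measurableT mk.
rewrite (eq_integral (k ^~ A)); last by move=> x _; rewrite gee0_abs.
move=> [H1 H2]; split.
  by move=> /H1; apply: filterS => x; exact.
by move=> H; apply: H2; apply: filterS H.
Qed.

End Mixture.

Section MixtureProbability.
Context d d' (X : measurableType d) (Y : measurableType d') (R : realType).
Variables (mu : probability X R) (k : R.-pker X ~> Y).

(** A second name for [mixture], to which the structure of a probability can be
    attached because [mu] has mass 1. *)
Definition mixture_of : set Y -> \bar R := mixture mu k.

HB.instance Definition _ := Measure.on mixture_of.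

Let mixture_of_setT : mixture_of setT = 1%E.
Proof. exact/mixture_setT/probability_setT. Qed.

HB.instance Definition _ :=
  Measure_isProbability.Build _ _ _ mixture_of mixture_of_setT.

Definition mixture_probability : probability Y R := mixture_of.

End MixtureProbability.

Section ImageMeasure.
Context d d' (X : measurableType d) (Y : measurableType d') (R : realType).
Variables (m : {measure set X -> \bar R}) (f : X -> Y).
Hypothesis mf : measurable_fun setT f.

Let image0 : pushforward m f set0 = 0%E. Proof. exact: measure0. Qed.

Let image_ge0 A : (0 <= pushforward m f A)%E. Proof. exact: measure_ge0. Qed.

Let image_sigma_additive : semi_sigma_additive (pushforward m f).
Proof. exact: measure_semi_sigma_additive. Qed.

Definition image_measure (A : set Y) : \bar R := pushforward m f A.

HB.instance Definition _ := isMeasure.Build _ _ _ image_measure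
  image0 image_ge0 image_sigma_additive.

Definition law : {measure set Y -> \bar R} := image_measure.

End ImageMeasure.

Section Density.
Context d (T : measurableType d) (R : realType) (mu : {measure set T -> \bar R}).
Variables (f : T -> \bar R) (mf : measurable_fun setT f).
Hypothesis f0 : forall x, (0 <= f x)%E.

Definition density (A : set T) : \bar R := (\int[mu]_(t in A) f t)%E.

Let density0 : density set0 = 0%E. Proof. by rewrite /density integral_set0. Qed.

Let density_ge0 A : (0 <= density A)%E. Proof. exact: integral_ge0. Qed.

Let density_sigma_additive : semi_sigma_additive density.
Proof. exact: semi_sigma_additive_nng_induced. Qed.

HB.instance Definition _ := isMeasure.Build _ _ _ density
  density0 density_ge0 density_sigma_additive.

Definition density_measure : {measure set T -> \bar R} := density.

End Density.

Section FubiniNull.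
Context d d' (X : measurableType d) (Y : measurableType d') (R : realType).
Variables (m1 : {sigma_finite_measure set X -> \bar R})
          (m2 : {sigma_finite_measure set Y -> \bar R}).

Lemma product_null_xsection (W : set (X * Y)) : measurable W ->
  (m1 \x m2)%E W = 0%E <-> \forall x \ae m1, m2 (xsection W x) = 0%E.
Proof.
move=> mW; have mk : measurable_fun setT (m2 \o xsection W).
  exact: measurable_fun_xsection.
have := ae_eq_integral_abs m1 measurableT mk.
rewrite (eq_integral (m2 \o xsection W)); last first.
  by move=> x _; rewrite gee0_abs//=.
move=> [H1 H2]; split.
  by move=> /H1; apply: filterS => x; exact.
by move=> H; apply: H2; apply: filterS H.
Qed.

Lemma product_null_ysection (W : set (X * Y)) : measurable W ->
  (m1 \x m2)%E W = 0%E <-> \forall y \ae m2, m1 (ysection W y) = 0%E.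
Proof.
move=> mW; have mk : measurable_fun setT (m1 \o ysection W).
  exact: measurable_fun_ysection.
rewrite (@product_measure_unique _ _ _ _ _ m1 m2 (m1 \x^ m2)%E)//; last first.
  by move=> A B mA mB; exact: product_measure2E.
have := ae_eq_integral_abs m2 measurableT mk.
rewrite (eq_integral (m1 \o ysection W)); last first.
  by move=> x _; rewrite gee0_abs//=.
move=> [H1 H2]; split.
  by move=> /H1; apply: filterS => x; exact.
by move=> H; apply: H2; apply: filterS H.
Qed.

End FubiniNull.

Section RealMeasures.
Variable R : realType.
Notation leb := (@lebesgue_measure R).

(** The translate of the measure gives half-open intervals their length, which
    determines Lebesgue measure. *)
Lemma lebesgue_measure_shift (a : R) (A : set R) : measurable A ->
  leb ((fun s => s + a) @^-1` A) = leb A.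
Proof.
move=> mA; change (pushforward leb ((fun s => s + a) : _ -> measurableTypeR R) A = leb A).
apply/esym/lebesgue_measure_unique => //=.
  exact: measurable_funD.
move=> _ _ [[x y] _ <-] /=; rewrite /pushforward.
rewrite (_ : _ @^-1` _ = `]x - a, y - a]%classic).
  by rewrite !lebesgue_measure_itv/= !lte_fin ltrD2r -!EFinB opprB addrA subrK.
by apply/seteqP; split => s /=; rewrite !in_itv/= ltrBlDr lerBrDr.
Qed.

Lemma prod_ray_generated d (T : measurableType d) :
  @measurable _ (T * R)%type =
  <<s [set W | exists A (t : R), measurable A /\ W = A `*` `]t, +oo[%classic] >>.
Proof.
set G := [set W | _]; apply/seteqP; split; last first.
  apply: smallest_sub; first exact: sigma_algebra_measurable.
  by move=> _ [A [t [mA ->]]]; apply: measurableX.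
rewrite measurable_prod_measurableType.
apply: smallest_sub; first exact: smallest_sigma_algebra.
move=> _ [A mA [B mB <-]].
have sG : sigma_algebra setT <<s G>> by exact: smallest_sigma_algebra.
have AT : <<s G>> (A `*` setT).
  rewrite (_ : _ `*` _ = \bigcup_n (A `*` `]- n%:R, +oo[%classic)).
    case: sG => _ _; apply => n; apply: sub_sigma_algebra.
    by exists A, (- n%:R).
  apply/seteqP; split => [[x t] [/= Ax _]|[x t] [n _ []]//].
  exists (Num.truncn (`|t|)).+1 => //; split => //=.
  rewrite in_itv/= andbT ltrNl (le_lt_trans (ler_norm _))// normrN.
  exact: truncnS_gt.
have {mB} : (RGenOInfty.G (R := R)).-sigma.-measurable B.
  by rewrite -RGenOInfty.measurableE.
move: B; apply: smallest_sub; last first.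
  by move=> _ [t ->]; apply: sub_sigma_algebra; exists A, t.
split => /=.
- by rewrite setX0; case: sG.
- move=> B AB; rewrite setTD (_ : _ `*` _ = (A `*` setT) `\` (A `*` B)).
    exact: (@measurableD _ (g_sigma_algebraType G) _ _ AT AB).
  apply/seteqP; split => [[x t] [/= Ax Bt]|[x t] [[/= Ax _] nB]]; split => //.
    by move=> [].
  by move=> Bt; apply: nB.
- by move=> F FG; rewrite setX_bigcupr; case: sG => _ _; apply.
Qed.

(** Products of a measurable set and an open half-line are stable under
    intersection and generate the product sigma-algebra.  For a pair consisting
    of a position and a duration these are the sets whose probability the
    survival functions give. *)
Lemma measure_unique_ray d (T : measurableType d)
    (m1 m2 : {measure set (T * R) -> \bar R}) :
  (m1 setT < +oo)%E ->
  (forall A (t : R), measurable A ->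
    m1 (A `*` `]t, +oo[%classic) = m2 (A `*` `]t, +oo[%classic)) ->
  forall W, measurable W -> m1 W = m2 W.
Proof.
move=> fin H W mW.
refine (@measure_unique _ R (T * R)%type _
  (fun n => setT `*` `]- n%:R, +oo[%classic) (prod_ray_generated T)
  _ _ _ m1 m2 _ _ W mW).
- move=> _ _ [A [t [mA ->]]] [B [s [mB ->]]].
  exists (A `&` B), (Num.max t s); split; first exact: measurableI.
  rewrite -setXI; congr (_ `*` _).
  by apply/seteqP; split => x /=; rewrite !in_itv/= !andbT gt_max => /andP.
- by move=> n; exists setT, (- n%:R).
- apply/seteqP; split => // -[x t] _.
  exists (Num.truncn (`|t|)).+1 => //; split => //=.
  rewrite in_itv/= andbT ltrNl (le_lt_trans (ler_norm _))// normrN.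
  exact: truncnS_gt.
- by move=> _ [A [t [mA ->]]]; exact: H.
- move=> n; apply: le_lt_trans fin; apply: le_measure => //; rewrite inE//.
  exact: measurableX.
Qed.

End RealMeasures.

(** * The law of a time with a continuous hazard rate *)

Section ExponentialLaw.
Variable R : realType.
Notation leb := (@lebesgue_measure R).
Context d (Om : measurableType d) (P : {measure set Om -> \bar R}) (T : Om -> R).
Hypothesis P_setT : P setT = 1%E.
Hypothesis mT : measurable_fun setT T.
Variables (f : R -> R) (b : R).
Hypothesis b0 : 0 < b.
Hypothesis cf : {within `[0, b], continuous f}.
Hypothesis f0 : forall u, 0 <= u <= b -> 0 <= f u.
Hypothesis PT : forall t, 0 <= t <= b ->
  P [set w | t < T w] = (expR (- (\int[leb]_(u in `[0%R, t]) f u)))%:E.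

Let H t := \int[leb]_(u in `[0%R, t]) f u.
Let g t := f t * expR (- H t).

Let intf : leb.-integrable `[0, b] (EFin \o f).
Proof. by apply: continuous_compact_integrable => //; exact: segment_compact. Qed.

Let cH : {within `[0, b], continuous H}.
Proof. by apply: (parameterized_integral_continuous (ltW b0) intf). Qed.

Let cF : {within `[0, b], continuous (fun t => - expR (- H t))}.
Proof.
move=> x; apply: (@continuousN _ _ _ (fun t : subspace `[0, b] => expR (- H t)) x).
apply: continuous_comp; last exact: continuous_expR.
by apply: (@continuousN _ _ _ (H : subspace `[0, b] -> R) x); exact: cH.
Qed.

Let cg : {within `[0, b], continuous g}.
Proof.
move=> x; apply: (@continuousM _ _ (f : subspace `[0, b] -> R) (fun t : subspace `[0, b] => expR (- H t)) x).
  exact: cf.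
apply: continuous_comp; last exact: continuous_expR.
by apply: (@continuousN _ _ _ (H : subspace `[0, b] -> R) x); exact: cH.
Qed.

Let g_ge0 u : 0 <= u <= b -> 0 <= g u.
Proof. by move=> ub; rewrite mulr_ge0 ?f0// ltW// expR_gt0. Qed.

(** The density [g] of the time is minus the derivative of its survival
    function. *)
Let FTC s : 0 <= s < b ->
  (\int[leb]_(u in `]s, b]) (g u)%:E = (expR (- H s) - expR (- H b))%:E)%E.
Proof.
move=> /andP[s0 sb].
have sub x : x \in `[s, b] -> x \in `[0, b].
  by rewrite !in_itv/= => /andP[sx ->]; rewrite (le_trans s0).
have subo x : x \in `]s, b[ -> x \in `]0, b[.
  by rewrite !in_itv/= => /andP[sx ->]; rewrite (le_lt_trans s0).
have cgs : {within `[s, b], continuous g}.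
  by apply: continuous_subspaceW cg => x /=; exact: sub.
have cFs : {within `[s, b], continuous (fun t => - expR (- H t))}.
  by apply: continuous_subspaceW cF => x /=; exact: sub.
have dF x : x \in `]s, b[ -> is_derive x 1 (fun t => - expR (- H t)) (g x).
  move=> /subo xb; have xb' := xb; move: xb'; rewrite in_itv/= => /andP[x0 xltb].
  have [dH HE] := continuous_FTC1_closed xltb intf x0
    (within_continuous_continuous b0 cf xb).
  have dH' : is_derive x 1 H (f x).
    by rewrite -HE derive1E; apply: DeriveDef.
  have -> : g x = - (expR (- H x) * - f x) by rewrite mulrN opprK mulrC.
  have N1 : is_derive x 1 (fun t => - H t) (- f x) := is_deriveN dH'.
  have D1 : is_derive x 1 (fun t => expR (- H t)) (expR (- H x) * - f x) :=
    is_derive1_comp (g := fun t => - H t) (is_derive_expR (- H x)) N1.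
  have D := is_deriveN D1.
  exact D.
rewrite integral_itv_obnd_cbnd; last first.
  apply/measurable_EFinP; apply: (@measurable_funS _ _ _ _ `[s, b]) => //.
    by move=> y /=; rewrite !in_itv/= => /andP[/ltW -> ->].
  exact: subspace_continuous_measurable_fun.
have LR : derivable_oo_LRcontinuous (fun t => - expR (- H t)) s b.
  have [_ l r] := (continuous_within_itvP _ sb).1 cFs.
  by split; [move=> x /dF[] |exact: l|exact: r].
rewrite (continuous_FTC2 sb cgs LR); last first.
  by move=> x xb; rewrite derive1E; have [_ ->] := dF x xb.
by rewrite -EFinN -EFinD opprK addrC.
Qed.

Let mI : measurable (`]0, b]%classic : set R). Proof. exact: measurable_itv. Qed.

Let g' : R -> \bar R := (fun u => (g u)%:E) \_ `]0, b].

Let mg : measurable_fun (`]0, b] : set R) (fun u => (g u)%:E).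
Proof.
apply/measurable_EFinP; apply: (@measurable_funS _ _ _ _ `[0, b]) => //.
  by move=> y /=; rewrite !in_itv/= => /andP[/ltW -> ->].
exact: subspace_continuous_measurable_fun.
Qed.

Let mg' : measurable_fun setT g'.
Proof. exact/(measurable_restrictT _ mI). Qed.

Let g'0 u : (0 <= g' u)%E.
Proof.
rewrite /g' patchE; case: ifPn => // /set_mem /=; rewrite in_itv/= => /andP[u0 ub].
by rewrite lee_fin g_ge0// ub ltW.
Qed.

Let P_fin A : measurable A -> (P A < +oo)%E.
Proof.
move=> mA; apply: (@le_lt_trans _ _ (P setT)); last by rewrite P_setT ltry.
by apply: le_measure; rewrite ?inE.
Qed.

(** The law of the time on [`]0, b]] and the measure with density [g]; they agree
    on half-lines, hence everywhere. *)
Let m1 : {measure set (measurableTypeR R) -> \bar R} :=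
  mrestr (law (Y := measurableTypeR R) P mT) mI.

Let m2 : {measure set (measurableTypeR R) -> \bar R} := density_measure leb mg' g'0.

Let m12 (A : set R) : measurable A -> m1 A = m2 A.
Proof.
move=> mA.
have P1 t : 0 <= t <= b -> P [set w | t < T w <= b] = (expR (- H t) - expR (- H b))%:E.
  move=> tb.
  have mr s : measurable [set w | s < T w].
    rewrite (_ : [set w | _] = T @^-1` `]s, +oo[); last first.
      by apply/seteqP; split => w /=; rewrite in_itv/= andbT.
    by rewrite -[X in measurable X]setTI; exact: mT.
  rewrite (_ : [set w | _] = [set w | t < T w] `\` [set w | b < T w]); last first.
    apply/seteqP; split => w /=.
      by move=> /andP[-> Tb]; split => //; apply/negP; rewrite -leNgt.
    by move=> [-> /negP]; rewrite -leNgt.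
  rewrite measureD//; last exact: P_fin.
  rewrite setIidr; last first.
    by move=> w /=; apply: le_lt_trans; case/andP: tb.
  rewrite EFinB; congr (_ - _)%E; first exact: PT.
  by apply: PT; rewrite lexx andbT ltW.
refine (@measure_unique _ R (measurableTypeR R) (RGenOInfty.G (R := R)) (fun n => `]- n%:R, +oo[%classic)
  (RGenOInfty.measurableE _) _ _ _ m1 m2 _ _ A mA).
- move=> _ _ [t ->] [s ->]; exists (Num.max t s).
  by apply/seteqP; split => x /=; rewrite !in_itv/= !andbT gt_max => /andP.
- by move=> n; exists (- n%:R).
- apply/seteqP; split => // t _.
  exists (Num.truncn (`|t|)).+1 => //=.
  rewrite in_itv/= andbT ltrNl (le_lt_trans (ler_norm _))// normrN.
  exact: truncnS_gt.
- move=> _ [t ->]; rewrite /m1 /m2 /= /mrestr /law /= /image_measure /pushforward /=.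
  rewrite /density /g' -integral_mkcondr; pose s := Num.max t 0.
  have s0 : 0 <= s by rewrite le_max lexx orbT.
  have -> : `]t, +oo[ `&` `]0, b] = `]s, b]%classic :> set R.
    apply/seteqP; split => u /=; rewrite !in_itv/= andbT gt_max.
      by move=> [-> /andP[-> ->]].
    by move=> /andP[/andP[-> ->] ->].
  have [sb|bs] := ltP s b; last first.
    by rewrite set_itv_ge ?bnd_simp -?leNgt// preimage_set0 measure0 integral_set0.
  rewrite FTC ?s0// -P1 ?s0 ?ltW//; congr (P _).
- move=> n; rewrite /m1 /= /mrestr /law /= /image_measure /pushforward /=.
  apply: P_fin.
  by rewrite -[X in measurable X]setTI; apply: mT => //; exact: measurableI.
Qed.

(** The density [g] of the time vanishes exactly where the hazard rate [f]
    does. *)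
Lemma exp_law_null (B : set R) : measurable B -> B `<=` `]0, b] ->
  leb.-negligible (B `&` [set u | 0 < f u]) -> P (T @^-1` B) = 0%E.
Proof.
move=> mB Bb Bf.
have <- : m1 B = P (T @^-1` B).
  by rewrite /m1 /= /mrestr /law /= /image_measure /pushforward setIidl.
rewrite m12// /m2 /= /density.
rewrite (@ae_eq_integral _ _ _ leb B (cst 0%E))//.
- by rewrite integral_cst// mul0e.
- exact: measurable_funTS.
apply: negligibleS Bf => u /= => /not_implyP[Bu gu]; split => //=.
have := Bb _ Bu; rewrite /= in_itv/= => /andP[u0 ub].
rewrite lt_neqAle f0 ?ub ?andbT ?ltW//; apply/eqP => fu.
apply: gu; rewrite /g' patchE; case: ifP => // _.
by rewrite /g -fu mul0r.
Qed.

End ExponentialLaw.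

(** * Orbits in the disjoint union of the modes *)

Section HybridOrbits.
Variables (R : realType) (k : nat) (d : 'I_k.+1 -> nat) (C : characteristics R d).
Hypothesis hC : is_characteristics C.
Implicit Types q : hybrid R d.

Lemma inner_not_active q : inner C q -> ~ active_boundary C q.
Proof. by move=> iq [[_ nq] _]. Qed.

Lemma inner_state q : inner C q -> state_space C q.
Proof. by left. Qed.

Lemma closure_inner (j : 'I_k.+1) (y : 'rV[R]_(d j)) :
  closure (@dom _ _ _ C j) y -> closure (inner C) (existT _ j y).
Proof.
move=> cy B nB; have nB' : nbhs y (existT (fun j => 'rV[R]_(d j)) j @^-1` B) by exact: nB.
by have [z [Dz Bz]] := cy _ nB'; exists (existT _ j z).
Qed.

Lemma state_origin q : state_space C q -> exists x a,
  [/\ orbit_origin (@dom _ _ _ C (projT1 q)) (@flow _ _ _ C (projT1 q)) (projT2 q) x a,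
      flow C (projT2 q) 0 = projT2 q &
      a = 0 \/ flow C x s @[s --> (- a)^'+] --> flow C x (- a)].
Proof.
case: (pselect (inner C q)) => [iq _|nq [//|]].
  exists (projT2 q), 0; split; last by left.
    exact: orbit_origin_inner.
  exact: (flow0 (@flowP _ _ _ _ hC _)).
case=> _ [[j x] [t [ix t0 Hs qE]]]; rewrite {}qE /= in nq *.
have Dv v : - t < v <= 0 -> dom C (flow C x v).
  move=> /andP[tv v0]; rewrite -(opprK v); apply: (Hs (- v)).
  by rewrite oppr_ge0 v0 ltrNl.
have oo := orbit_origin_entrance (@flowP _ _ _ _ hC j) ix t0 Hs nq.
exists x, t; split => //.
- have [_ _ _ ->//] := oo; first by rewrite sub0r.
  by move=> s; rewrite sub0r => /andP[s0 st]; exfalso; have := t0; lra.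
- right; apply: (flow_entrance (@flowP _ _ _ _ hC j)) => //.
  by rewrite oppr_lt0.
Qed.

Lemma hflow0 q : state_space C q -> hflow C q 0 = q.
Proof. by case: q => j y sq; have [x [a [_ y0 _]]] := state_origin sq; rewrite /hflow y0. Qed.

(** Until the entrance time [a] has elapsed the orbit is inside because its
    origin is; afterwards it is an orbit that starts inside, and the first point
    outside is by definition in the active boundary. *)
Lemma orbit_dichotomy q t : state_space C q -> 0 <= t ->
  (forall u, 0 < u <= t -> inner C (hflow C q u)) \/
  (exists e, [/\ 0 < e, e <= t, active_boundary C (hflow C q e) &
     forall u, 0 < u < e -> inner C (hflow C q u)]).
Proof.
move=> sq t0; have [x [a [oq y0 _]]] := state_origin sq.
have [Dx a0 Da H] := oq.
have hf := @flowP _ _ _ _ hC (projT1 q); have oD := @dom_open _ _ _ _ hC (projT1 q).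
have [ta|at_] := ltP t a.
  left => u /andP[u0 ut]; rewrite /inner /hflow /= H ?ltW//.
    by apply: Da; lra.
  by move=> s; lra.
have ta0 : 0 <= t - a by rewrite subr_ge0.
have D0 v : - a < v -> v <= 0 -> dom C (flow C x v) by move=> ? ?; apply: Da; apply/andP.
have [Hu|[e [e0 et De nD]]] := flow_first_exit oD hf Dx ta0.
  left => u /andP[u0 ut]; rewrite /inner /hflow /= H ?ltW//.
    have [ua|ua] := leP (u - a) 0; first by apply: D0 => //; lra.
    by apply: Hu; lra.
  by move=> s /andP[s0 su]; apply: Hu; lra.
have He u : 0 <= u -> u <= e + a -> flow C (projT2 q) u = flow C x (u - a).
  by move=> u0 ue; apply: H => // s /andP[s0 su]; apply: De; lra.
right; exists (e + a); split.
- by lra.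
- by lra.
- rewrite /hflow He ?addrK ?lexx//; last by lra.
  split.
    split; last exact: nD.
    by apply: closure_inner; exact: (flow_exit_closure hf Dx e0 De).
  by exists (existT _ (projT1 q) x), e; split.
- move=> u /andP[u0 ue]; rewrite /inner /hflow /= He ?ltW//.
  have [ua|ua] := leP (u - a) 0; first by apply: D0 => //; lra.
  by apply: De; lra.
Qed.

Lemma exit_time_le q t : 0 <= t -> active_boundary C (hflow C q t) ->
  (exit_time C q <= t%:E)%E.
Proof. by move=> t0 At; apply: ereal_inf_lbound; exists t. Qed.

Lemma exit_time_ge0 q : (0 <= exit_time C q)%E.
Proof. by apply: le_ereal_inf_tmp => _ [t [t0 _] <-]; rewrite lee_fin. Qed.

Lemma inner_before_exit q u : state_space C q -> 0 < u ->
  (u%:E < exit_time C q)%E -> inner C (hflow C q u).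
Proof.
move=> sq u0 ut; have [H|[e [e0 eu Ae _]]] := orbit_dichotomy sq (ltW u0).
  by apply: H; rewrite u0 lexx.
have := lt_le_trans ut (exit_time_le (ltW e0) Ae).
by rewrite lte_fin ltNge eu.
Qed.

(** The orbit meets the active boundary for the first time after time 0 at a
    time [f] and is inside before, so that the infimum that defines the exit
    time is [f], unless it is attained at 0. *)
Lemma exit_time_attained q e : state_space C q -> exit_time C q = e%:E ->
  active_boundary C (hflow C q e).
Proof.
move=> sq qe.
have e0 : 0 <= e by have := exit_time_ge0 q; rewrite qe.
have [A0|nA0] := pselect (active_boundary C (hflow C q 0)).
  have := exit_time_le (lexx 0) A0; rewrite qe lee_fin => e0'.
  by rewrite (_ : e = 0)//; apply/eqP; rewrite eq_le e0'.
have [u [u0 Au]] : exists u, 0 <= u /\ active_boundary C (hflow C q u).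
  have : (exit_time C q < (e + 1)%:E)%E by rewrite qe lte_fin ltrDl.
  by move=> /ereal_inf_lt[_ [u Hu _] _]; exists u.
have u0' : 0 < u.
  by rewrite lt_neqAle u0 andbT; apply/eqP => u00; apply: nA0; rewrite u00.
have [H|[f [f0 fu Af Hf]]] := orbit_dichotomy sq u0.
  by exfalso; apply: (inner_not_active _ Au); apply: H; rewrite u0' lexx.
suff -> : e = f by [].
have ef : e <= f by rewrite -lee_fin -qe exit_time_le// ltW.
suff fe : f <= e by apply/eqP; rewrite eq_le ef.
rewrite -lee_fin -qe.
apply: le_ereal_inf_tmp => _ [v [v0 Av] <-]; rewrite lee_fin leNgt; apply/negP => vf.
have [v00|v00] := eqVneq v 0; first by apply: nA0; rewrite -v00.
by apply: (inner_not_active _ Av); apply: Hf; rewrite vf andbT lt_neqAle eq_sym v00.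
Qed.

Lemma exit_time_room q b : (b%:E < exit_time C q)%E ->
  exists2 t, b < t & (t%:E < exit_time C q)%E.
Proof.
case: (exit_time C q) => [e| |]//.
  by rewrite lte_fin => be; exists ((b + e) / 2); rewrite ?lte_fin; lra.
by move=> _; exists (b + 1); rewrite ?ltry//; lra.
Qed.

Lemma orbit_is_derive q u : state_space C q -> 0 < u -> (u%:E < exit_time C q)%E ->
  is_derive u 1 (flow C (projT2 q)) (vf C (flow C (projT2 q) u)).
Proof.
move=> sq u0 ue; have [t ut te] := exit_time_room ue.
have [x [a [oq _ _]]] := state_origin sq.
apply: (orbit_derive (@dom_open _ _ _ _ hC _) (@flowP _ _ _ _ hC _) oq (t := t)); last by rewrite u0.
move=> w /andP[w0 wt]; apply: (inner_before_exit sq w0).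
by apply: lt_trans te; rewrite lte_fin.
Qed.

Lemma orbit_right_continuous q u : state_space C q -> 0 <= u ->
  (u%:E < exit_time C q)%E ->
  flow C (projT2 q) w @[w --> u^'+] --> flow C (projT2 q) u.
Proof.
move=> sq; rewrite le_eqVlt => /predU1P[<-|u0] ue; last first.
  apply: cvg_at_right_filter; apply: differentiable_continuous.
  by apply/derivable1_diffP; have [] := orbit_is_derive sq u0 ue.
have [t t0 te] := exit_time_room ue.
have [x [a [oq y0 ca]]] := state_origin sq.
apply: (orbit_cvg_right0 (@dom_open _ _ _ _ hC _) (@flowP _ _ _ _ hC _) oq y0 t0 ca).
move=> w /andP[w0 wt]; apply: (inner_before_exit sq w0).
by apply: lt_trans te; rewrite lte_fin.
Qed.

Lemma orbit_state q u : state_space C q -> 0 <= u -> (u%:E < exit_time C q)%E ->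
  state_space C (hflow C q u).
Proof.
move=> sq; rewrite le_eqVlt => /predU1P[<-|u0] ue; first by rewrite hflow0.
by apply: inner_state; exact: inner_before_exit.
Qed.

Lemma orbit_within_continuous q b : state_space C q -> 0 < b -> (b%:E < exit_time C q)%E ->
  {within `[0, b], continuous (hflow C q)}.
Proof.
move=> sq b0 be.
have cw : {within `[0, b], continuous (flow C (projT2 q))}.
  apply/(continuous_within_itvP _ b0); split.
  - move=> u; rewrite in_itv/= => /andP[u0 ub].
    apply: differentiable_continuous.
    apply/derivable1_diffP; have [] // := orbit_is_derive sq u0 _.
    by apply: lt_trans be; rewrite lte_fin.
  - apply: orbit_right_continuous => //.
    by apply: lt_trans be; rewrite lte_fin.
  - apply: cvg_at_left_filter; apply: differentiable_continuous.
    by apply/derivable1_diffP; have [] := orbit_is_derive sq b0 be.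
by move=> u; apply: continuous_comp; [exact: cw|exact: existT_continuous].
Qed.

Hypothesis B3 : {within state_space C, continuous (rate C)}.

Lemma orbit_rate_continuous q b : state_space C q -> 0 < b -> (b%:E < exit_time C q)%E ->
  {within `[0, b], continuous (fun u => rate C (hflow C q u))}.
Proof.
move=> sq b0 be; apply/subspace_continuousP => u /= ub; have := ub.
rewrite in_itv/= => /andP[u0 ub'].
have ue v : v <= b -> (v%:E < exit_time C q)%E by move=> vb; apply: le_lt_trans be; rewrite lee_fin.
have cw := (subspace_continuousP _ _).1 (orbit_within_continuous sq b0 be) u ub.
have cr := (subspace_continuousP _ _).1 B3 _ (orbit_state sq u0 (ue _ ub')).
apply: cvg_trans cr => A /= nA.
have H0 : \forall w \near u, `[0, b]%classic w ->
    state_space C (hflow C q w) -> A (rate C (hflow C q w)) by exact: (cw _ nA).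
change (\forall w \near u, `[0, b]%classic w -> A (rate C (hflow C q w))).
apply: filterS H0 => w H wb; apply: H => //.
by move: wb; rewrite /= in_itv/= => /andP[w0 wb]; apply: orbit_state => //; exact: ue.
Qed.

End HybridOrbits.

(** * The process until a jump *)

Lemma null_setC d (T : measurableType d) (R : realType)
    (m : {measure set T -> \bar R}) (A : set T) :
  m setT = 1%E -> measurable A -> m A = 1%E -> m (~` A) = 0%E.
Proof.
move=> mT mA A1.
have E : (m (setT `\` A) = m setT - m (setT `&` A))%E.
  by apply: measureD => //; apply: le_lt_trans (ltry 1); rewrite -mT.
by move: E; rewrite setTD setTI mT A1 subee.
Qed.

Section Pdmp.
Variables (R : realType) (k : nat) (d : 'I_k.+1 -> nat) (C : characteristics R d).
Hypothesis hC : is_characteristics C.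
Variables (dO : measure_display) (Omega : measurableType dO)
  (P : R.-pker (hybrid R d) ~> Omega) (X : R -> Omega -> hybrid R d)
  (T : nat -> Omega -> R) (Q : nat -> Omega -> hybrid R d).
Hypothesis hX : is_pdmp C P X T Q.
Implicit Types q : hybrid R d.
Notation leb := (@lebesgue_measure R).

Lemma measurable_open_hybrid (A : set (hybrid R d)) : open A -> measurable A.
Proof. exact: sub_sigma_algebra. Qed.

Lemma measurable_set1_hybrid q : measurable [set q].
Proof.
rewrite -[[set q]]setCK; apply: measurableC; apply: measurable_open_hybrid.
apply/sigT_openP => j; case: q => j0 y.
have [jj0|jj0] := eqVneq j j0; last first.
  rewrite (_ : _ @^-1` _ = setT); first exact: openT.
  apply/seteqP; split => // z _ /= E.
  by move/eqP: jj0; apply; exact: (congr1 (@projT1 _ _) E).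
subst j; rewrite (_ : _ @^-1` _ = ~` [set y]).
  by apply: closed_openC; exact: (accessible_closed_set1 (hausdorff_accessible (@norm_hausdorff _ _))).
apply/seteqP; split => z /= nz zy; apply: nz; first by rewrite zy.
apply/eqP; have <- := @eq_Tagged 'I_k.+1 (fun j => 'rV[R]_(d j)) (existT _ j0 z) y.
exact/eqP.
Qed.

Lemma history_gen n m l A : (l <= n)%N -> measurable A ->
  history T Q n m (Q l @^-1` A).
Proof. by move=> ln mA; apply: sub_sigma_algebra; left; exists l, A. Qed.

Lemma start_set_measurable q : measurable (Q 0%N @^-1` [set q]).
Proof.
rewrite -[X in measurable X]setTI; apply: (measurable_Q hX 0) => //.
exact: measurable_set1_hybrid.
Qed.

(** Conditioning on the start turns the relations between positions, times and
    orbits, which hold path by path, into statements about one orbit. *)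
Lemma measure_start q (A : set Omega) : state_space C q -> measurable A ->
  P q (Q 0%N @^-1` [set q] `&` A) = P q A.
Proof.
move=> sq mA; have mF := start_set_measurable q.
have F1 := Q_start hX sq.
have F0 : P q (~` (Q 0%N @^-1` [set q])) = 0%E.
  exact: null_setC (prob_kernel q) mF F1.
apply/eqP; rewrite eq_le; apply/andP; split.
  by apply: le_measure; rewrite ?inE//; exact: measurableI.
rewrite -{1}(setIT A) -(setUv (Q 0%N @^-1` [set q])) setIUr.
apply: le_trans (measureU2 _ _ _) _; [exact: measurableI|apply: measurableI => //; exact: measurableC|].
rewrite setIC [X in (_ + X)%E](_ : _ = 0%E) ?adde0//.
by apply: subset_measure0 F0 => //; [apply: measurableI => //|]; exact: measurableC.
Qed.

Definition gap n w := T n.+1 w - T n w.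

Lemma gap0 w : gap 0 w = T 1%N w.
Proof. by rewrite /gap (T_start hX) subr0. Qed.

Lemma gap_ge0 n w : 0 <= gap n w.
Proof. by rewrite subr_ge0 (T_nondecreasing hX). Qed.

Lemma measurable_gap n : measurable_fun setT (gap n).
Proof. by apply: measurable_funB; exact: (measurable_T hX). Qed.

Lemma measurable_gap_gt n t : measurable [set w | t < gap n w].
Proof.
rewrite (_ : [set w | _] = gap n @^-1` `]t, +oo[); last first.
  by apply/seteqP; split => w /=; rewrite in_itv/= andbT.
by rewrite -[X in measurable X]setTI; exact: measurable_gap.
Qed.

(** The survival function, written as a value of the kernel [P]: in this form it
    is measurable in [q]. *)
Definition tail q t : \bar R := P q [set w | t < gap 0 w].

Lemma tail_survival q t : state_space C q -> 0 <= t -> tail q t = survival C q t.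
Proof.
move=> sq t0; rewrite /tail -measure_start//; last exact: measurable_gap_gt.
have hF : history T Q 0 0 (Q 0%N @^-1` [set q]).
  by apply: history_gen => //; exact: measurable_set1_hybrid.
rewrite (jump_time_law hX sq hF t0).
rewrite (eq_integral (cst (survival C q t))); last by move=> w /set_mem /= ->.
rewrite integral_cst//; last exact: start_set_measurable.
by rewrite (Q_start hX)// mule1.
Qed.

Lemma measurable_tail t : measurable_fun setT (tail ^~ t).
Proof. by apply: measurable_kernel; exact: measurable_gap_gt. Qed.

Hypothesis B3 : {within state_space C, continuous (rate C)}.

Lemma survival_before_exit q b t : state_space C q -> 0 < b ->
  (b%:E < exit_time C q)%E -> 0 <= t <= b ->
  survival C q t = (expR (- (\int[leb]_(u in `[0%R, t]) rate C (hflow C q u))))%:E.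
Proof.
move=> sq b0 be /andP[t0 tb]; rewrite /survival (le_lt_trans _ be) ?lee_fin//.
have ci : leb.-integrable `[0, t] (EFin \o (fun u => rate C (hflow C q u))).
  apply: continuous_compact_integrable; first exact: segment_compact.
  apply: continuous_subspaceW (orbit_rate_continuous hC B3 sq b0 be).
  by move=> u /=; rewrite !in_itv/= => /andP[-> ut]; rewrite (le_trans ut).
rewrite /cumulated_rate -[X in (- X)%E]fineK//.
exact: integrable_fin_num ci.
Qed.

Lemma tail_gt0 q t : state_space C q -> 0 <= t ->
  (0 < tail q t)%E = (t%:E < exit_time C q)%E.
Proof.
move=> sq t0; rewrite tail_survival//; have [te|te] := ltP t%:E (exit_time C q).
  have [b tb be] := exit_time_room te.
  rewrite (survival_before_exit sq (le_lt_trans t0 tb) be) ?t0 ?ltW//.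
  by rewrite lte_fin expR_gt0.
by rewrite /survival (_ : (t%:E < exit_time C q)%E = false) ?ltxx// ltNge te.
Qed.

(** Let [M] be the event that there is no jump until [t] and that [X t] is in
    [B].  From [q] it has probability [tail q t] if the flow leads to [B], and 0
    otherwise; as [tail q t] is positive before the exit, the set in question is
    the set where the measurable function [P q M] is not 0. *)
Lemma measurable_flow_at t B : 0 <= t -> measurable B -> measurable
  [set q | [/\ state_space C q, (t%:E < exit_time C q)%E & B (hflow C q t)]].
Proof.
move=> t0 mB; pose M := [set w | t < gap 0 w] `&` X t @^-1` B.
have mX : measurable (X t @^-1` B).
  by rewrite -[X in measurable X]setTI; apply: (measurable_X hX).
have mM : measurable M by apply: measurableI => //; exact: measurable_gap_gt.
have PM q : state_space C q -> P q M = if `[< B (hflow C q t) >] then tail q t else 0%E.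
  move=> sq; rewrite -measure_start//.
  have XE w : (Q 0%N @^-1` [set q] `&` [set w | t < gap 0 w]) w -> X t w = hflow C q t.
    move=> [/= <-]; rewrite gap0 => tT; rewrite (X_path hX (n := 0)) (T_start hX) ?subr0//.
    by rewrite t0.
  case: asboolP => Bq.
    rewrite /tail -[RHS]measure_start//; last exact: measurable_gap_gt.
    congr (P q _); apply/seteqP; split => w; first by move=> [? []].
    by move=> wF; split; [case: wF|split; [case: wF|rewrite /= XE]].
  rewrite (_ : _ `&` _ = set0) ?measure0//.
  by apply/seteqP; split => // w [Fw [gw /=]]; rewrite XE.
rewrite (_ : [set q | _] = state_space C `&` (P ^~ M) @^-1` [set~ 0%E]).
  apply: measurableI; first exact: measurable_state_space.
  rewrite -[X in measurable X]setTI; apply: measurable_kernel => //.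
  by apply: measurableC.
apply/seteqP; split => [q [sq te Bq]|q [sq /= +]].
  split => //= ; rewrite PM// asboolT// => E0.
  by move: te; rewrite -tail_gt0// E0 ltxx.
rewrite PM//; case: asboolP => // Bq tn0; split => //.
by rewrite -tail_gt0// lt_neqAle measure_ge0 andbT eq_sym; exact/eqP.
Qed.

Definition alive (B : set (hybrid R d)) : set (hybrid R d * measurableTypeR R) :=
  [set p | [/\ state_space C p.1, 0 <= p.2, (p.2%:E < exit_time C p.1)%E &
             B (hflow C p.1 p.2)]].

(** These sets increase to [O] when [O] is open, and they are closed: a limit of
    points of one of them is still in [O]. *)
Definition erosion (O : set (hybrid R d)) (m : nat) : set (hybrid R d) :=
  [set x : hybrid R d | forall z : 'rV[R]_(d (projT1 x)),
     `|projT2 x - z| < m.+1%:R^-1 -> O (existT _ (projT1 x) z)].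

Lemma measurable_erosion O m : measurable (erosion O m).
Proof.
rewrite -[erosion O m]setCK; apply: measurableC; apply: measurable_open_hybrid.
apply/sigT_openP => j.
rewrite (_ : _ @^-1` _ = \bigcup_(z in [set z | ~ O (existT _ j z)]) ball z m.+1%:R^-1).
  by apply: bigcup_open => z _; exact: ball_open.
apply/seteqP; split => y /=.
  move=> /existsNP[z /not_implyP[yz nO]]; exists z => //.
  by rewrite -ball_normE /= distrC.
move=> [z nO]; rewrite -ball_normE /= distrC => zy H; apply: nO.
exact: (H z).
Qed.

(** The least multiple of [1 / m.+1] strictly after [u]: approximating times
    from the right is what right continuous orbits allow. *)
Definition grid_after (m : nat) (u : R) : R := (Num.truncn (u * m.+1%:R)).+1%:R / m.+1%:R.

Lemma grid_after_bounds m u : 0 <= u -> u < grid_after m u <= u + m.+1%:R^-1.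
Proof.
move=> u0; have m0 : 0 < m.+1%:R :> R by [].
have um0 : 0 <= u * m.+1%:R by rewrite mulr_ge0.
have /andP[a1 a2] := truncn_itv um0.
rewrite /grid_after ltr_pdivlMr// a2/= -natr1 mulrDl mul1r lerD2r.
by rewrite ler_pdivrMr.
Qed.

(** The position at [u] is the limit of the positions at the grid times after
    [u].  It is in the open set [O] if and only if these are eventually at a
    fixed distance from the complement of [O]. *)
Lemma alive_approx O : open O -> alive O =
  \bigcup_m \bigcup_N \bigcap_(l in [set l | (N <= l)%N])
    [set p | 0 <= p.2 /\ [/\ state_space C p.1, ((grid_after l p.2)%:E < exit_time C p.1)%E &
      erosion O m (hflow C p.1 (grid_after l p.2))]].
Proof.
move=> oO; apply/seteqP; split => -[q u].
- move=> [/= sq u0 ue Ou]; have [t ut te] := exit_time_room ue.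
  have := (sigT_openP O).1 oO (projT1 q); rewrite openE => /(_ _ Ou).
  rewrite /interior /= => /nbhs_ballP[e /= e0 He].
  have e2 : 0 < e / 2 by rewrite divr_gt0.
  have [m _ /(_ m (leqnn m)) mM] := near_infty_natSinv_lt (PosNum e2).
  have /cvgrPdist_lt/(_ _ e2)[dl /= dl0 Hd] := orbit_right_continuous hC sq u0 ue.
  have d0 : 0 < Num.min dl (t - u) by rewrite lt_min dl0 subr_gt0.
  have [N _ HN] := near_infty_natSinv_lt (PosNum d0).
  exists m => //; exists N => // l /= Nl; split => //.
  have /andP[ul lu] := grid_after_bounds l u0.
  have := HN l Nl; rewrite /= lt_min => /andP[ld lt].
  have gd : `|u - grid_after l u| < dl.
    by rewrite distrC gtr0_norm ?subr_gt0// ltrBlDl; apply: (le_lt_trans lu); rewrite ltrD2l.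
  split => //.
    by apply: lt_trans te; rewrite lte_fin; apply: (le_lt_trans lu); rewrite -ltrBrDl.
  move=> z /= zl; apply: He; rewrite -ball_normE /=.
  have := Hd _ gd ul.
  rewrite -[X in `|X| < e](subrKA (flow C (projT2 q) (grid_after l u))) => h1.
  apply: le_lt_trans (ler_normD _ _) _.
  have zl2 : `|flow C (projT2 q) (grid_after l u) - z| < e / 2 by apply: lt_trans mM.
  by move: zl2 h1 => /=; lra.
- move=> [m _ [N _ H]]; have [/= u0 [sq _ _]] := H N (leqnn N).
  have ue : (u%:E < exit_time C q)%E.
    have [_ [_ + _]] := H N (leqnn N); apply: le_lt_trans.
    by rewrite lee_fin ltW//; have /andP[] := grid_after_bounds N u0.
  split => //=.
  have m0 : 0 < m.+1%:R^-1 :> R by rewrite invr_gt0.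
  have /cvgrPdist_lt/(_ _ m0)[dl /= dl0 Hd] := orbit_right_continuous hC sq u0 ue.
  have [N' _ HN] := near_infty_natSinv_lt (PosNum dl0).
  pose l := maxn N N'; have [_ [_ _ Hl]] := H l (leq_maxl _ _).
  have /andP[ul lu] := grid_after_bounds l u0.
  have gd : `|u - grid_after l u| < dl.
    rewrite distrC gtr0_norm ?subr_gt0// ltrBlDl; apply: (le_lt_trans lu).
    by rewrite ltrD2l; exact: (HN l (leq_maxr _ _)).
  by apply: Hl => /=; rewrite distrC; exact: Hd.
Qed.

(** For an open set the approximation involves countably many times only.  The
    sets [B] for which the claim holds form a sigma-algebra, complements being
    taken relative to [alive setT]. *)
Lemma measurable_alive B : measurable B -> measurable (alive B).
Proof.
have mO O : open O -> measurable (alive O).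
  move=> oO; rewrite alive_approx//.
  apply: bigcupT_measurable => m; apply: bigcupT_measurable => N.
  apply: bigcap_measurable; first by exists N => /=.
  move=> l _; have l0 : 0 < l.+1%:R :> R by [].
  rewrite (_ : [set p | _] = \bigcup_j
    ([set q | [/\ state_space C q, ((j.+1%:R / l.+1%:R)%:E < exit_time C q)%E &
       erosion O m (hflow C q (j.+1%:R / l.+1%:R))]] `*`
     (`[j%:R / l.+1%:R, j.+1%:R / l.+1%:R[%classic : set (measurableTypeR R)))).
    apply: bigcupT_measurable => j; apply: measurableX.
      by apply: measurable_flow_at; [rewrite divr_ge0|exact: measurable_erosion].
    exact: measurable_itv.
  apply/seteqP; split => -[q u] /=.
    move=> [u0 H]; exists (Num.truncn (u * l.+1%:R)) => //; split => //=.
    rewrite in_itv/= ler_pdivrMr// ltr_pdivlMr//.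
    by apply: truncn_itv; rewrite mulr_ge0.
  move=> [j _ [/= H]]; rewrite in_itv/= ler_pdivrMr// ltr_pdivlMr// => ju.
  have u0 : 0 <= u.
    by rewrite -(pmulr_lge0 _ l0); apply: le_trans (andP ju).1.
  split => //; rewrite /grid_after (_ : Num.truncn _ = j)//.
  exact: truncn_def.
have mT : measurable (alive setT) by apply: mO; exact: openT.
move: B; apply: smallest_sub; last exact: mO.
split => /=.
- rewrite (_ : alive set0 = set0)//.
  by apply/seteqP; split => // p [].
- move=> B mB; rewrite (_ : alive _ = alive setT `\` alive B).
    exact: measurableD.
  apply/seteqP; split => p.
    by move=> [sp p0 pe [_ nB]]; split => // -[].
  by move=> [[sp p0 pe _] nB]; split => //; split => // Bp; apply: nB.
- move=> F mF; rewrite (_ : alive _ = \bigcup_i alive (F i)).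
    exact: bigcupT_measurable.
  apply/seteqP; split => p; first by move=> [sp p0 pe [i _ Fi]]; exists i.
  by move=> [i _ [sp p0 pe Fi]]; split => //; exists i.
Qed.

Lemma measurable_Q_preimage n A : measurable A -> measurable (Q n @^-1` A).
Proof. by move=> mA; rewrite -[X in measurable X]setTI; exact: (measurable_Q hX). Qed.

Lemma measurable_running t : 0 <= t ->
  measurable [set q | state_space C q /\ (t%:E < exit_time C q)%E].
Proof.
move=> t0; rewrite (_ : [set q | _] =
    [set q | [/\ state_space C q, (t%:E < exit_time C q)%E & [set: hybrid R d] (hflow C q t)]]).
  exact: measurable_flow_at.
by apply/seteqP; split => q [].
Qed.

(** The bad event that a sojourn goes on after its orbit has left the domain,
    with a fixed time as witness; rational witnesses suffice. *)
Definition overshoot n t : set Omega :=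
  [set w | t < gap n w] `&` Q n @^-1` [set q | (exit_time C q <= t%:E)%E].

Lemma overshootE n t : overshoot n t = [set w | t < gap n w] `&`
  Q n @^-1` (~` [set q | state_space C q /\ (t%:E < exit_time C q)%E]).
Proof.
apply/seteqP; split => w [/= tg H]; split => //=.
  by move=> [_]; rewrite ltNge H.
by rewrite leNgt; apply/negP => H'; apply: H; split => //; exact: (Q_state hX).
Qed.

Lemma measurable_overshoot n t : 0 <= t -> measurable (overshoot n t).
Proof.
move=> t0; rewrite overshootE; apply: measurableI; first exact: measurable_gap_gt.
by apply: measurable_Q_preimage; apply: measurableC; exact: measurable_running.
Qed.

Lemma overshoot_null x n t : state_space C x -> 0 <= t -> P x (overshoot n t) = 0%E.
Proof.
move=> sx t0; rewrite overshootE setIC.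
have mA : measurable (~` [set q | state_space C q /\ (t%:E < exit_time C q)%E]).
  by apply: measurableC; exact: measurable_running.
rewrite (jump_time_law hX sx (history_gen (leqnn n) mA) t0).
rewrite (eq_integral (cst 0%E)) ?integral0// => w /set_mem /= Hw.
rewrite /survival ifF//; apply/negP => te; apply: Hw.
by split => //; exact: (Q_state hX).
Qed.

Lemma gap_le_exit n w : (forall p : rat, 0 <= ratr p :> R -> ~ overshoot n (ratr p) w) ->
  ((gap n w)%:E <= exit_time C (Q n w))%E.
Proof.
move=> H; rewrite leNgt; apply/negP.
have := exit_time_ge0 C (Q n w); case E : (exit_time C (Q n w)) => [e| |]//.
rewrite lee_fin lte_fin => e0 eg; have [p] := rat_in_itvoo eg.
rewrite in_itv/= => /andP[ep pg]; apply: (H p); first by rewrite ltW// (le_lt_trans e0).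
by split => //=; rewrite E lee_fin ltW.
Qed.

(** The conditional probability, given the past up to [T n], that the sojourn
    lasts longer than [t] is [tail (Q n w) t], which is positive before the exit
    time.  So the condition [t < gap n] can be dropped from null events. *)
Lemma running_null x n t A : state_space C x -> 0 <= t -> measurable A ->
  (forall q, A q -> state_space C q -> (t%:E < exit_time C q)%E) ->
  P x (Q n @^-1` A `&` [set w | t < gap n w]) = 0%E -> P x (Q n @^-1` A) = 0%E.
Proof.
move=> sx t0 mA At.
rewrite (jump_time_law hX sx (history_gen (leqnn n) mA) t0).
have mQA := measurable_Q_preimage n mA.
rewrite (eq_integral (fun w => tail (Q n w) t)); last first.
  by move=> w _; rewrite tail_survival//; exact: (Q_state hX).
have mt : measurable_fun (Q n @^-1` A) (fun w => tail (Q n w) t).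
  apply: measurable_funTS; apply: (measurableT_comp (measurable_tail t)).
  exact: (measurable_Q hX).
have := ae_eq_integral_abs (P x) mQA mt.
rewrite (eq_integral (fun w => tail (Q n w) t)); last first.
  by move=> w _; rewrite gee0_abs// measure_ge0.
move=> [H _] /H; move=> [N [mN N0 HN]]; apply: (subset_measure0 mQA mN _ N0).
move=> w Aw; apply: HN => /= /(_ Aw) t00.
have := tail_gt0 (Q_state hX n w) t0; rewrite t00 ltxx.
by rewrite (At _ Aw (Q_state hX n w)).
Qed.

Lemma markov_joint x n A t : state_space C x -> measurable A ->
  P x (Q n @^-1` A `&` [set w | t < gap n w]) =
  (\int[P x]_w P (Q n w) (Q 0%N @^-1` A `&` [set v | (t < gap 0 v)%R]))%E.
Proof.
move=> sx mA; have mQA := measurable_Q_preimage n mA.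
have H q : state_space C q -> P q (Q 0%N @^-1` A `&` [set v | t < gap 0 v]) =
    if `[< A q >] then tail q t else 0%E.
  move=> sq; rewrite -measure_start//; last first.
    by apply: measurableI; [exact: measurable_Q_preimage|exact: measurable_gap_gt].
  case: asboolP => Aq.
    rewrite /tail -[RHS]measure_start//; last exact: measurable_gap_gt.
    congr (P q _); apply/seteqP; split => v [/= vq]; first by move=> [].
    by move=> vt; split => //; split => //=; rewrite vq.
  rewrite (_ : _ `&` _ = set0) ?measure0//.
  by apply/seteqP; split => // v [/= vq [/=]]; rewrite vq.
rewrite (eq_integral ((fun w => tail (Q n w) t) \_ (Q n @^-1` A))); last first.
  move=> w _; rewrite H; last exact: (Q_state hX).
  rewrite patchE; case: asboolP => Aq; first by rewrite mem_set.
  by rewrite memNset.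
rewrite -integral_mkcond.
have [t0|t0] := leP 0 t.
  rewrite (jump_time_law hX sx (history_gen (leqnn n) mA) t0).
  by apply: eq_integral => w _; rewrite tail_survival//; exact: (Q_state hX).
rewrite (eq_integral (cst 1%E)); last first.
  move=> w _; rewrite /tail (_ : [set _ | _] = setT); first exact: prob_kernel.
  by apply/seteqP; split => // v _ /=; rewrite (lt_le_trans t0)// gap_ge0.
rewrite integral_cst// mul1e; congr (P x _); apply/seteqP; split => w; first by case.
by move=> Aw; split => //=; rewrite (lt_le_trans t0)// gap_ge0.
Qed.

Lemma measurable_Qgap n : measurable_fun setT
  (fun w => (Q n w, gap n w) : hybrid R d * R).
Proof.
by apply/measurable_fun_pairP; split; [exact: (measurable_Q hX)|exact: measurable_gap].
Qed.

(** Given [Q n], the length of the sojourn is distributed as [T 1] for the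
    process started at [Q n].  The law of sojourn lengths is prescribed through
    survival functions, that is on half-lines, and these determine it. *)
Lemma markov x n (W : set (hybrid R d * R)) : state_space C x -> measurable W ->
  P x ((fun w => (Q n w, gap n w)) @^-1` W) =
  (\int[P x]_w P (Q n w) ((fun v => (Q 0%N v, gap 0 v)) @^-1` W))%E.
Proof.
move=> sx mW.
pose m1 := law (P x) (measurable_Qgap n).
pose m2 := law (mixture_measure (law (P x) (measurable_Q hX n)) P) (measurable_Qgap 0).
have m2E (V : set (hybrid R d * R)) : measurable V ->
    m2 V = (\int[P x]_w P (Q n w) ((fun v => (Q 0%N v, gap 0 v)) @^-1` V))%E.
  move=> mV; rewrite /m2 /law /= /image_measure /pushforward /=.
  have mk : measurable_fun setT (fun q => P q ((fun v => (Q 0%N v, gap 0 v)) @^-1` V)).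
    apply: measurable_kernel; rewrite -[X in measurable X]setTI.
    exact: measurable_Qgap.
  exact: (ge0_integral_pushforward (measurable_Q hX n) (P x) measurableT mk).
rewrite -m2E//; apply: (@measure_unique_ray R _ _ m1 m2) => //.
- rewrite /m1 /law /= /image_measure /pushforward preimage_setT.
  by apply: (le_lt_trans _ (ltry 1)); rewrite -(prob_kernel (s := P) x).
- move=> A t mA; rewrite m2E; last by apply: measurableX.
  rewrite /m1 /law /= /image_measure /pushforward.
  have E m : (fun w => (Q m w, gap m w)) @^-1` (A `*` `]t, +oo[) =
      Q m @^-1` A `&` [set w | t < gap m w].
    by apply/seteqP; split => w [/= Aw]; rewrite in_itv/= andbT.
  rewrite !E markov_joint//.
Qed.

(** * The stationary process *)

Variable nu : probability (hybrid R d) R.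
Hypothesis stat : is_stationary C P X nu.

Notation PP := (mixture_probability nu P).

Lemma nu_stateC : nu (~` state_space C) = 0%E.
Proof.
apply: null_setC; [exact: probability_setT|exact: measurable_state_space|].
by case: stat.
Qed.

Lemma ae_state : \forall x \ae nu, state_space C x.
Proof.
exists (~` state_space C); split => //.
  by apply: measurableC; exact: measurable_state_space.
exact: nu_stateC.
Qed.

Lemma PP_null A : measurable A -> (forall x, state_space C x -> P x A = 0%E) ->
  PP A = 0%E.
Proof.
move=> mA H; apply/(mixture_eq0 nu P mA); apply: filterS ae_state.
exact: H.
Qed.

Lemma PP_null_ae A : measurable A -> PP A = 0%E -> \forall x \ae nu, P x A = 0%E.
Proof. by move=> mA /(mixture_eq0 nu P mA). Qed.

Lemma PP_X t A : 0 <= t -> measurable A -> PP (X t @^-1` A) = nu A.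
Proof.
move=> t0 mA; have [_ H] := stat; rewrite -(H t A t0 mA).
have mE := measurable_state_space hC.
have mX : measurable (X t @^-1` A).
  by rewrite -[X in measurable X]setTI; apply: (measurable_X hX).
have mk : measurable_fun setT (fun x => P x (X t @^-1` A)) by apply: measurable_kernel.
rewrite [RHS]integral_mkcond.
change (\int[nu]_x P x (X t @^-1` A) =
  \int[nu]_x ((fun x => P x (X t @^-1` A)) \_ (state_space C)) x)%E.
apply: ae_eq_integral => //.
  by apply/(measurable_restrictT _ mE); exact: measurable_funTS.
apply: filterS ae_state => x sx _ /=.
by rewrite patchE mem_set.
Qed.

(** Ages count from the beginning of the sojourn, times from the beginning of
    the process.  Stationarity speaks of times, the law of a sojourn of ages. *)
Definition ages n A : set (Omega * measurableTypeR R) :=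
  [set p | alive A (Q n p.1, p.2) /\ p.2 < gap n p.1].

Definition times n A : set (Omega * measurableTypeR R) :=
  [set p | ages n A (p.1, p.2 - T n p.1)].

Lemma measurable_alive_at n A : measurable A ->
  measurable [set p : Omega * measurableTypeR R | alive A (Q n p.1, p.2)].
Proof.
move=> mA; have mf : measurable_fun setT
    (fun p : Omega * measurableTypeR R => (Q n p.1, p.2)).
  apply/measurable_fun_pairP; split; last exact: measurable_snd.
  exact: (measurableT_comp (measurable_Q hX n) measurable_fst).
by have := mf measurableT _ (measurable_alive mA); rewrite setTI.
Qed.

Lemma measurable_ages n A : measurable A -> measurable (ages n A).
Proof.
move=> mA; apply: measurableI; first exact: measurable_alive_at.
have mf : measurable_fun setT (fun p : Omega * measurableTypeR R => gap n p.1 - p.2).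
  apply: measurable_funB; last exact: measurable_snd.
  exact: (measurableT_comp (measurable_gap n) measurable_fst).
have := mf measurableT _ (measurable_itv `]0, +oo[); rewrite setTI.
congr measurable; apply/seteqP; split => p /=; rewrite in_itv/= andbT subr_gt0//.
Qed.

Lemma measurable_times n A : measurable A -> measurable (times n A).
Proof.
move=> mA.
have mf : measurable_fun setT
    (fun p : Omega * measurableTypeR R => (p.1, p.2 - T n p.1) : Omega * measurableTypeR R).
  apply/measurable_fun_pairP; split; first exact: measurable_fst.
  apply: measurable_funB; first exact: measurable_snd.
  exact: (measurableT_comp (measurable_T hX n) measurable_fst).
by have := mf measurableT _ (measurable_ages n mA); rewrite setTI.
Qed.

Lemma xsection_times n A w : measurable A ->
  leb (xsection (times n A) w) = leb (xsection (ages n A) w).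
Proof.
move=> mA; rewrite -(@lebesgue_measure_shift R (- T n w) (xsection (ages n A) w)); last first.
  by apply: measurable_xsection; exact: measurable_ages.
by congr leb; apply/seteqP; split => s; rewrite /xsection /= !inE.
Qed.

Lemma times_ages_null n A : measurable A ->
  (PP \x leb)%E (times n A) = 0%E <-> (PP \x leb)%E (ages n A) = 0%E.
Proof.
move=> mA; have H w := xsection_times n w mA.
split => /product_null_xsection.
  move=> /(_ (measurable_times n mA)) Hw.
  apply/(product_null_xsection PP leb (measurable_ages n mA)).
  by apply: filterS Hw => w; exact: (etrans (esym (H w))).
move=> /(_ (measurable_ages n mA)) Hw.
apply/(product_null_xsection PP leb (measurable_times n mA)).
by apply: filterS Hw => w; exact: (etrans (H w)).
Qed.

Lemma T_ge0 n w : 0 <= T n w.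
Proof.
elim: n => [|n IH]; first by rewrite (T_start hX).
exact: (le_trans IH (T_nondecreasing hX n w)).
Qed.

Lemma times_X n A w s : times n A (w, s) -> 0 <= s /\ A (X s w).
Proof.
move=> [[/= sq u0 ue Aw] ug].
have Ts : T n w <= s by rewrite -subr_ge0.
split; first exact: le_trans (T_ge0 n w) Ts.
by rewrite (X_path hX (n := n))// Ts/= -(ltrD2r (- T n w)).
Qed.

(** The process is in [A] with probability 0 at every time, so almost surely at
    almost no age of the sojourn.  By Fubini, at almost every age [u] it is a
    null event that the orbit is in [A] and the sojourn lasts longer than [u],
    and [running_null] removes the condition on the length.  Freeing the orbit
    from the sojourn makes it possible to draw the length independently of the
    set of ages to be avoided. *)
Lemma sojourn_avoids_null n A : measurable A -> nu A = 0%E ->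
  \forall w \ae PP, leb (xsection
     [set p : Omega * measurableTypeR R | alive A (Q n p.1, p.2)] w) = 0%E.
Proof.
move=> mA nuA; have mB := measurable_alive_at n mA.
apply/(product_null_xsection PP leb mB)/(product_null_ysection PP leb mB).
have : (PP \x leb)%E (ages n A) = 0%E.
  apply/(times_ages_null n mA).
  apply/(product_null_ysection PP leb (measurable_times n mA)).
  apply: aeW => s; have [s0|s0] := leP 0 s; last first.
    rewrite (_ : ysection _ _ = set0) ?measure0//.
    by apply/seteqP; split => // w; rewrite /ysection /= inE => /times_X[]; rewrite leNgt s0.
  apply: (subset_measure0 (mu := PP) _ _ _ (etrans (PP_X s0 mA) nuA)).
  - by apply: measurable_ysection; exact: measurable_times.
  - by rewrite -[X in measurable X]setTI; apply: (measurable_X hX).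
  - by move=> w; rewrite /ysection /= inE => /times_X[].
move=> /(product_null_ysection PP leb (measurable_ages n mA)); apply: filterS => u Hu.
have [u0|u0] := leP 0 u; last first.
  rewrite (_ : ysection _ _ = set0) ?measure0//.
  by apply/seteqP; split => // w; rewrite /ysection /= inE => -[_ /=]; rewrite leNgt u0.
pose Au := [set q | [/\ state_space C q, (u%:E < exit_time C q)%E & A (hflow C q u)]].
have mAu : measurable Au by exact: measurable_flow_at.
have E1 : ysection [set p : Omega * measurableTypeR R | alive A (Q n p.1, p.2)] u = Q n @^-1` Au.
  by apply/seteqP; split => w; rewrite /ysection /= inE => -[].
have E2 : ysection (ages n A) u = Q n @^-1` Au `&` [set w | u < gap n w].
  apply/seteqP; split => w; rewrite /ysection /= inE; first by move=> [[]].
  by move=> [[]].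
rewrite E1; have mQA := measurable_Q_preimage n mAu.
apply/(mixture_eq0 nu P mQA).
move: Hu; rewrite E2 => /PP_null_ae.
move=> /(_ (measurableI _ _ mQA (measurable_gap_gt n u))).
apply: filterS2 ae_state => x sx; apply: running_null => //.
by move=> q [].
Qed.

Lemma ae_gap_le_exit n : \forall w \ae PP, ((gap n w)%:E <= exit_time C (Q n w))%E.
Proof.
have H : \forall w \ae PP, forall m : nat, forall p : rat,
    @choice.pickle_inv rat m = Some p -> 0 <= ratr p :> R -> ~ overshoot n (ratr p) w.
  apply: ae_foralln => m; case E : (@choice.pickle_inv rat m) => [p|]; last exact: aeW.
  have [p0|p0] := leP 0 (ratr p : R); last first.
    by apply: aeW => w _ [<-]; rewrite leNgt p0.
  exists (overshoot n (ratr p)); split; first exact: measurable_overshoot.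
    apply: PP_null; first exact: measurable_overshoot.
    by move=> x sx; exact: overshoot_null.
  by move=> w /= H; apply: contrapT => H'; apply: H => _ [<-] _.
apply: filterS H => w H; apply: gap_le_exit => p p0.
by apply: (H (pickle p)) => //; rewrite pickleK_inv.
Qed.

Hypothesis A3 : forall x t, state_space C x -> 0 < t ->
  (\int[P x]_w jump_count T t w < +oo)%E.

Definition exploded t : set Omega := [set w | forall n, T n.+1 w <= t].

Lemma measurable_T_le n t : measurable [set w | T n w <= t].
Proof.
have := measurable_T hX n measurableT (measurable_itv `]-oo, t]); rewrite setTI.
by congr measurable; apply/seteqP; split => w /=; rewrite in_itv.
Qed.

Lemma measurable_exploded t : measurable (exploded t).
Proof.
rewrite (_ : exploded t = \bigcap_n [set w | T n.+1 w <= t]).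
  by apply: bigcapT_measurable => n; exact: measurable_T_le.
by apply/seteqP; split => w H n; [move=> _; exact: H|exact: (H n Logic.I)].
Qed.

(** On this event the number of jumps before [t], which has finite expectation,
    is infinite. *)
Lemma exploded_null x t : state_space C x -> 0 < t -> P x (exploded t) = 0%E.
Proof.
move=> sx t0; have mB := measurable_exploded t.
have jc0 w : (0 <= jump_count T t w)%E.
  by apply: nneseries_ge0 => n _ _; rewrite lee_fin.
have mjc : measurable_fun setT (jump_count T t).
  apply: ge0_emeasurable_sum => [n w _ _|n _]; first by rewrite lee_fin.
  apply/measurable_EFinP.
  rewrite (_ : (fun w => _) = \1_[set w | T n.+1 w <= t]); last first.
    by apply/funext => w; rewrite indicE; congr (_%:R); rewrite mem_setE.
  by apply: measurable_indic; exact: measurable_T_le.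
have [N [mN N0 HN]] : \forall w \ae P x, setT w -> jump_count T t w \is a fin_num.
  apply: (integrable_ae measurableT); apply/integrableP; split => //.
  by under eq_integral do rewrite gee0_abs//; exact: A3.
apply: (subset_measure0 mB mN _ N0) => w Ew; apply: HN => /= /(_ Logic.I).
rewrite ge0_fin_numE; last exact: jc0.
rewrite ltey => /negP; apply; apply/eqP/eq_infty => r.
rewrite /jump_count.
apply: (@le_trans _ _ (\sum_(0 <= n < (Num.truncn r).+1) ((T n.+1 w <= t)%R%:R)%:E)%E); last first.
  by apply: nneseries_lim_ge => n _ _; rewrite lee_fin.
under eq_bigr do rewrite Ew.
rewrite sumEFin lee_fin sumr_const_nat subn0.
by apply: ltW; exact: truncnS_gt.
Qed.

Lemma PP_first_gap_small (e : R) : 0 < e -> exists N : nat, forall s, N%:R <= s ->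
  (PP [set w | (s < gap 0 w)%R] < e%:E)%E.
Proof.
move=> e0; pose F (N : nat) := [set w | N%:R < gap 0 w].
have F0 : \bigcap_N F N = set0.
  apply/seteqP; split => // w H.
  have := H (Num.truncn (gap 0 w)).+1 Logic.I; rewrite /F /= ltNge ltW//.
  exact: truncnS_gt.
have : (PP \o F) x @[x --> \oo] --> PP (\bigcap_n F n).
  apply: nonincreasing_cvg_mu.
  - by apply: (le_lt_trans _ (ltry 1)); exact: probability_le1 (measurable_gap_gt _ _).
  - by move=> i; exact: measurable_gap_gt.
  - by rewrite F0.
  - move=> n m nm; apply/subsetPset => w /=; apply: le_lt_trans.
    by rewrite ler_nat.
rewrite F0 measure0 => /fine_cvgP[_] /cvgrPdist_lt/(_ _ e0)[N _ /(_ N (leqnn N))].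
rewrite /= sub0r normrN ger0_norm ?fine_ge0// => He.
exists N => s Ns; apply: (@le_lt_trans _ _ (PP (F N))).
  apply: le_measure; rewrite ?inE; [exact: measurable_gap_gt|exact: measurable_gap_gt|].
  by move=> w /=; apply: le_lt_trans.
by rewrite -[ltLHS]fineK ?lte_fin// fin_num_measure//; exact: measurable_gap_gt.
Qed.

(** At time [s] the process has law [nu].  As it does not explode, [s] belongs to
    some sojourn, and by assumption to the first one if the position is in
    [A]. *)
Lemma nu_le_first_gap A s : measurable A -> 0 < s ->
  (forall n, PP (ysection (times n.+1 A) s) = 0%E) ->
  (nu A <= PP [set w | (s < gap 0 w)%R])%E.
Proof.
move=> mA s0 H.
have mX : measurable (X s @^-1` A).
  by rewrite -[X in measurable X]setTI; apply: (measurable_X hX) => //; exact: ltW.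
rewrite -(PP_X (ltW s0) mA).
have N1 : \forall w \ae PP, ~ exploded s w.
  exists (exploded s); split; first exact: measurable_exploded.
    apply: PP_null; first exact: measurable_exploded.
    by move=> x sx; exact: exploded_null.
  by move=> w /= /contrapT.
have N2 : \forall w \ae PP, forall n, ~ ysection (times n.+1 A) s w.
  apply: ae_foralln => n; exists (ysection (times n.+1 A) s); split; first 1 last.
  - exact: H.
  - by move=> w /= /contrapT.
  - by apply: measurable_ysection; exact: measurable_times.
have N3 : \forall w \ae PP, forall n, ((gap n w)%:E <= exit_time C (Q n w))%E.
  by apply: ae_foralln => n; exact: ae_gap_le_exit.
have [M [mM M0 HM]] := filterI N1 (filterI N2 N3).
apply: (@le_trans _ _ (PP ([set w | s < gap 0 w] `|` M))); last first.
  apply: le_trans (measureU2 _ (measurable_gap_gt _ _) mM) _.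
  by rewrite /= M0 adde0.
apply: le_measure; rewrite ?inE//.
  by apply: measurableU => //; exact: measurable_gap_gt.
move=> w /= Aw; have [sg|gs] := ltP s (gap 0 w); first by left.
right; apply: HM => /= -[ne [nt ge]]; apply: ne => n.
elim: n => [|n IH]; first by rewrite -gap0.
rewrite leNgt; apply/negP => sT; apply: (nt n).
have sE : T n.+1 w <= s < T n.+2 w by rewrite IH.
have ug : s - T n.+1 w < gap n.+1 w by rewrite /gap ltrD2r.
rewrite /ysection /= inE; split => //=; split => /=.
- exact: (Q_state hX).
- by rewrite subr_ge0.
- by apply: lt_le_trans (ge n.+1); rewrite lte_fin.
- by rewrite -(X_path hX sE).
Qed.

(** The initial sojourn starts from [nu] itself, about which nothing is known,
    but it is over at a large time; this is why it does not appear in the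
    assumption. *)
Lemma null_of_sojourns A : measurable A ->
  (forall n, (PP \x leb)%E (ages n.+1 A) = 0%E) -> nu A = 0%E.
Proof.
move=> mA H.
have Hs : \forall s \ae leb, forall n, PP (ysection (times n.+1 A) s) = 0%E.
  apply: ae_foralln => n.
  apply/(product_null_ysection PP leb (measurable_times n.+1 mA)).
  exact/(times_ages_null n.+1 mA).
apply/eqP; rewrite eq_le measure_ge0 andbT; apply/lee_addgt0Pr => e e0.
rewrite add0e; have [N HN] := PP_first_gap_small e0.
have [s [Ns Hs0]] : exists s : R, N%:R < s /\ forall n, PP (ysection (times n.+1 A) s) = 0%E.
  apply: contrapT => nex; have [M [mM M0 HM]] := Hs.
  have : (leb `]N%:R, (N.+1)%:R] <= leb M)%E.
    apply: le_measure; rewrite ?inE//.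
    move=> s /=; rewrite in_itv/= => /andP[Ns _]; apply: HM => /= Hs0.
    by apply: nex; exists s.
  rewrite M0 lebesgue_measure_itv/= lte_fin ltr_nat ltnSn -EFinB lee_fin.
  by rewrite -natr1 addrAC subrr add0r ler10.
apply: (le_trans (nu_le_first_gap mA _ Hs0)); last by apply/ltW/HN/ltW.
by apply: le_lt_trans Ns.
Qed.

(** * Positions just before and just after a jump *)

(** The points from which spontaneous jumps occur. *)
Definition jumping : set (hybrid R d) := state_space C `&` rate C @^-1` `]0, +oo[.

Lemma measurable_jumping : measurable jumping.
Proof. exact: (measurable_rate hC) (measurable_state_space hC) _ (measurable_itv _). Qed.

(** Before the exit time the length of the sojourn has the hazard rate
    [rate C] along the orbit; continuity of this rate holds on closed intervals
    [`[0, b]] that end before the exit, and countably many of them are enough.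
    The length 0 has to be treated apart: it has no mass, since the survival
    function is 1 at time 0. *)
Lemma first_jump_avoids q Z : state_space C q -> measurable Z ->
  leb (xsection (alive (Z `&` jumping)) q) = 0%E ->
  P q ((fun v => (Q 0%N v, gap 0 v)) @^-1` alive Z) = 0%E.
Proof.
move=> sq mZ nul.
have mZj : measurable (Z `&` jumping) by apply: measurableI => //; exact: measurable_jumping.
have mW := measurable_xsection q (measurable_alive mZ).
have mWj := measurable_xsection q (measurable_alive mZj).
have mM : measurable ((fun v => (Q 0%N v, gap 0 v)) @^-1` alive Z).
  by rewrite -[X in measurable X]setTI; apply: (measurable_Qgap 0) => //; exact: measurable_alive.
have mgap (B : set R) : measurable B -> measurable (gap 0 @^-1` B).
  by move=> mB; rewrite -[X in measurable X]setTI; exact: measurable_gap.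
have pos : forall b : R, 0 < b -> (b%:E < exit_time C q)%E ->
    P q (gap 0 @^-1` (xsection (alive Z) q `&` `]0, b])) = 0%E.
  move=> b b0 be.
  apply: (@exp_law_null R _ _ (P q) (gap 0) (prob_kernel q) (measurable_gap 0)
    (fun u => rate C (hflow C q u)) b b0 _ _ _ (xsection (alive Z) q `&` `]0, b]%classic)).
  - exact: orbit_rate_continuous.
  - move=> u /andP[u0 ub]; apply: (rate_ge0 hC); apply: orbit_state => //.
    by apply: le_lt_trans be; rewrite lee_fin.
  - move=> t tb; rewrite -(survival_before_exit sq b0 be tb) -tail_survival//.
    by case/andP: tb.
  - by apply: measurableI.
  - by move=> u [].
  - exists (xsection (alive (Z `&` jumping)) q); split => //.
    move=> u [[]]; rewrite /xsection /= !inE => -[/= _ u0 ue Zu] _ ru.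
    split => //=; split => //; split; first exact: orbit_state.
    by rewrite /= in_itv/= andbT.
have zero : (0%:E < exit_time C q)%E -> P q (gap 0 @^-1` [set 0]) = 0%E.
  move=> e0.
  rewrite (_ : _ @^-1` _ = ~` [set w | 0 < gap 0 w]); last first.
    apply/seteqP; split => w /=; first by move=> ->; rewrite ltxx.
    by move=> /negP; rewrite -leNgt => g0; apply/eqP; rewrite eq_le g0 gap_ge0.
  apply: null_setC; [exact: prob_kernel|exact: measurable_gap_gt|].
  have [b b0 be] := exit_time_room e0.
  have := tail_survival sq (lexx 0); rewrite /tail => ->.
  rewrite (survival_before_exit sq b0 be) ?lexx ?ltW//.
  by rewrite set_itv1 Rintegral_set1 oppr0 expR0.
have N1 : \forall v \ae P q, Q 0%N v = q.
  exists (~` (Q 0%N @^-1` [set q])); split => //.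
    by apply: measurableC; exact: start_set_measurable.
  exact: null_setC (prob_kernel q) (start_set_measurable q) (Q_start hX sq).
have N2 : \forall v \ae P q, ~ ((0%:E < exit_time C q)%E /\ gap 0 v = 0).
  have [e0|e0] := boolP (0%:E < exit_time C q)%E; last by apply: aeW => v [].
  exists (gap 0 @^-1` [set 0]); split; [exact: mgap|exact: zero|].
  by move=> v /= /contrapT[].
have N3 : \forall v \ae P q, forall m : nat, forall p : rat,
    @choice.pickle_inv rat m = Some p -> 0 < ratr p :> R ->
    ((ratr p)%:E < exit_time C q)%E ->
    ~ (xsection (alive Z) q `&` `]0, ratr p]) (gap 0 v).
  apply: ae_foralln => m; case E : (@choice.pickle_inv rat m) => [p|]; last exact: aeW.
  have [p0|p0] := ltP 0 (ratr p : R); last first.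
    by apply: aeW => w _ [<-]; rewrite ltNge p0.
  have [pe|pe] := boolP ((ratr p)%:E < exit_time C q)%E; last first.
    by apply: aeW => w _ [<-] _ pe'; rewrite pe' in pe.
  exists (gap 0 @^-1` (xsection (alive Z) q `&` `]0, ratr p])); split.
  - by apply: mgap; apply: measurableI.
  - exact: pos.
  - by move=> w /= H; apply: contrapT => H'; apply: H => _ [<-] _ _.
have [M [mM' M0 HM]] := filterI N1 (filterI N2 N3).
apply: (subset_measure0 mM mM' _ M0) => v Wv; apply: HM => -[Qv [g0 gp]].
move: Wv => /=; rewrite Qv => Wv; have [/= _ u0 ue _] := Wv.
have [g00|g00] := eqVneq (gap 0 v) 0.
  by apply: g0; split => //; rewrite g00 in ue.
have gpos : 0 < gap 0 v by rewrite lt_neqAle eq_sym g00.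
have [t gt te] := exit_time_room ue; have [p] := rat_in_itvoo gt.
rewrite in_itv/= => /andP[pg pt].
apply: (gp (pickle p) p); first by rewrite pickleK_inv.
- exact: lt_trans pg.
- by apply: lt_trans te; rewrite lte_fin.
- by split; [rewrite /xsection /= inE|rewrite /= in_itv/= gpos ltW].
Qed.

(** Given [Q n], the ages at which the orbit is in the [nu]-null set
    [Z `&` jumping] are almost surely null by [sojourn_avoids_null], and
    [first_jump_avoids] applies to the process started at [Q n]. *)
Lemma sojourn_law_avoids n Z : measurable Z -> nu (Z `&` jumping) = 0%E ->
  PP ((fun v => (Q n v, gap n v)) @^-1` alive Z) = 0%E.
Proof.
move=> mZ nuZ.
have mZj : measurable (Z `&` jumping) by apply: measurableI => //; exact: measurable_jumping.
have mM m : measurable ((fun v => (Q m v, gap m v)) @^-1` alive Z).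
  by rewrite -[X in measurable X]setTI; apply: (measurable_Qgap m) => //; exact: measurable_alive.
pose f w := P (Q n w) ((fun v => (Q 0%N v, gap 0 v)) @^-1` alive Z).
have mf : measurable_fun setT f.
  apply: (measurableT_comp (f := fun q => P q ((fun v => (Q 0%N v, gap 0 v)) @^-1` alive Z))).
    by apply: measurable_kernel.
  exact: (measurable_Q hX).
have mB : measurable [set w | f w != 0%E].
  have := mf measurableT _ (measurableC (emeasurable_set1 0%E)); rewrite setTI.
  by congr measurable; apply/seteqP; split => w /= /eqP.
have fB : PP [set w | f w != 0%E] = 0%E.
  have [M [mM' M0 HM]] := sojourn_avoids_null n mZj nuZ.
  apply: (subset_measure0 mB mM' _ M0) => w /= fw; apply: HM => /= H.
  move/eqP: fw; apply; apply: first_jump_avoids => //; exact: (Q_state hX).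
apply/(mixture_eq0 nu P (mM n)); have := PP_null_ae mB fB.
apply: filterS2 ae_state => x sx Hx; rewrite markov//; last exact: measurable_alive.
have := ae_eq_integral_abs (P x) measurableT mf.
rewrite (eq_integral f); last by move=> w _; rewrite gee0_abs// measure_ge0.
move=> [_]; apply; exists [set w | f w != 0%E]; split => //.
by move=> w /= H; apply/eqP => fw; apply: H.
Qed.

Variable sigma : {finite_measure set (hybrid R d) -> \bar R}.
Hypothesis hsigma : is_boundary_measure C P T Q nu sigma.

(** The expected number of forced jumps from [Z] up to [t] is [t * sigma Z]. *)
Lemma forced_jump_null n Z : measurable Z -> Z `<=` active_boundary C ->
  sigma Z = 0%E -> PP (prejump C T Q n @^-1` Z) = 0%E.
Proof.
move=> mZ ZG sZ.
have mY m : measurable (prejump C T Q m @^-1` Z).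
  by rewrite -[X in measurable X]setTI; apply: (measurable_prejump hX m).
pose ev m (t : R) := [set w | T m.+1 w <= t] `&` prejump C T Q m @^-1` Z.
have mev m t : measurable (ev m t).
  by apply: measurableI => //; exact: measurable_T_le.
have evE m t w : ((T m.+1 w <= t) && `[< Z (prejump C T Q m w) >])%:R = \1_(ev m t) w :> R.
  rewrite indicE (_ : (T m.+1 w <= t) && _ = (w \in ev m t))//.
  apply/idP/idP; first by move=> /andP[Tt /asboolP Zw]; rewrite inE.
  by rewrite inE => -[/= -> Zw]; apply/asboolP.
have mF t : measurable_fun setT (forced_jump_count C T Q Z t).
  apply: ge0_emeasurable_sum => [m w _ _|m _]; first by rewrite lee_fin.
  apply/measurable_EFinP; rewrite (_ : (fun w => _) = \1_(ev m t)).
    exact: measurable_indic.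
  by apply/funext => w; rewrite evE.
have F0 t w : (0 <= forced_jump_count C T Q Z t w)%E.
  by apply: nneseries_ge0 => m _ _; rewrite lee_fin.
have evn t : 0 < t -> PP (ev n t) = 0%E.
  move=> t0; apply/(mixture_eq0 nu P (mev n t)).
  have mk : measurable_fun setT (fun x => \int[P x]_w forced_jump_count C T Q Z t w)%E.
    apply: measurable_fun_integral_kernel => //.
    by move=> U mU; exact: measurable_kernel.
  have k0 x : (0 <= \int[P x]_w forced_jump_count C T Q Z t w)%E by exact: integral_ge0.
  have ex0 : expect C P nu (forced_jump_count C T Q Z t) = 0%E.
    have [_ /(_ Z t mZ ZG t0)] := hsigma; rewrite sZ => /esym/eqP.
    rewrite mule_eq0 => /orP[/eqP//|/eqP[/eqP]].
    by rewrite gt_eqF// invr_gt0.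
  have := ae_eq_integral_abs nu (measurable_state_space hC) (measurable_funTS mk).
  rewrite (eq_integral (fun x => \int[P x]_w forced_jump_count C T Q Z t w)%E); last first.
    by move=> x _; rewrite gee0_abs.
  move=> [/(_ ex0) H _]; apply: filterS2 ae_state H => x sx /(_ sx) /= H.
  apply/eqP; rewrite eq_le measure_ge0 andbT -H.
  rewrite -[X in P x X]setIT -integral_indic//.
  apply: ge0_le_integral => //.
  - exact/measurable_EFinP/measurable_indic.
  - move=> w _; rewrite -evE /forced_jump_count.
    apply: le_trans (nneseries_lim_ge n.+1 _); last first.
      by move=> m _ _; rewrite lee_fin.
    by rewrite big_nat_recr//= leeDr// sume_ge0// => m _; rewrite lee_fin.
apply: (@subset_measure0 _ _ _ PP _ (\bigcup_m ev n m.+1%:R)) => //.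
- by apply: bigcupT_measurable => m.
- move=> w /= Zw; exists (Num.truncn (T n.+1 w)) => //; split => //=.
  by apply: ltW; exact: truncnS_gt.
- apply/(negligibleP PP); first by apply: bigcupT_measurable => m.
  apply: negligible_bigcup => m; apply/(negligibleP PP) => //.
  exact: evn.
Qed.

Variable piQ : probability (hybrid R d) R.
Hypothesis hpiQ : is_piQ C nu sigma piQ.

(** The two nonnegative integrals in the formula for [piQ] vanish, hence so do
    their integrands almost everywhere.  The normalizing factor is not 0 because
    [piQ] has mass 1. *)
Lemma piQ_null B : measurable B -> piQ B = 0%E ->
  nu ([set z | jump C z B != 0%E] `&` jumping) = 0%E /\
  sigma ([set z | jump C z B != 0%E] `&` active_boundary C) = 0%E.
Proof.
move=> mB; pose Z := [set z | jump C z B != 0%E].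
have mk : measurable_fun setT (fun z => jump C z B) by exact: measurable_kernel.
have mZ : measurable Z.
  have := mk measurableT _ (measurableC (emeasurable_set1 0%E)); rewrite setTI.
  by congr measurable; apply/seteqP; split => w /= /eqP.
have mE := measurable_state_space hC; have mG := measurable_active_boundary hC.
pose I1 (A : set (hybrid R d)) := (\int[nu]_(x in state_space C) ((rate C x)%:E * jump C x A))%E.
pose I2 (A : set (hybrid R d)) := (\int[sigma]_(x in active_boundary C) jump C x A)%E.
have I10 A : (0 <= I1 A)%E.
  by apply: integral_ge0 => x sx; rewrite mule_ge0// lee_fin (rate_ge0 hC).
have I20 A : (0 <= I2 A)%E by apply: integral_ge0.
have c0 : (fine (xi_mass C nu sigma))^-1 != 0.
  apply/eqP => c0; have := hpiQ measurableT; rewrite probability_setT c0 mul0e => /eqP.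
  by rewrite eqe oner_eq0.
rewrite hpiQ// => /eqP; rewrite mule_eq0 eqe (negPf c0) /=.
rewrite -/(I1 B) -/(I2 B) padde_eq0// => /andP[/eqP I1B /eqP I2B]; split.
- have mf : measurable_fun (state_space C) (fun x => (rate C x)%:E * jump C x B)%E.
    apply: emeasurable_funM; last exact: measurable_funTS.
    by apply/measurable_EFinP; exact: (measurable_rate hC).
  have := ae_eq_integral_abs nu mE mf.
  rewrite (eq_integral (fun x => (rate C x)%:E * jump C x B)%E); last first.
    by move=> x /set_mem sx; rewrite gee0_abs// mule_ge0// lee_fin (rate_ge0 hC).
  move=> [/(_ I1B)[M [mM M0 HM]] _].
  apply: (subset_measure0 _ mM _ M0); first by apply: measurableI => //; exact: measurable_jumping.
  move=> x [/= Zx [sx rx]]; apply: HM => /= /(_ sx)/eqP; rewrite mule_eq0 (negPf Zx) orbF.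
  by rewrite eqe gt_eqF//; move: rx; rewrite /= in_itv/= andbT.
- have := ae_eq_integral_abs sigma mG (measurable_funTS mk).
  rewrite (eq_integral (fun x => jump C x B)); last by move=> x _; rewrite gee0_abs.
  move=> [/(_ I2B)[M [mM M0 HM]] _].
  apply: (subset_measure0 _ mM _ M0); first exact: measurableI.
  by move=> x [/= Zx Gx]; apply: HM => /= /(_ Gx)/eqP; rewrite (negPf Zx).
Qed.

(** A sojourn ends at the exit time, on the active boundary, or before it, and
    the point from which it jumps is then almost surely not in the set [Z] from
    which jumps may lead to [B]. *)
Lemma postjump_null n B : measurable B -> piQ B = 0%E -> PP (Q n.+1 @^-1` B) = 0%E.
Proof.
move=> mB /(piQ_null mB)[nuZ sZ]; pose Z := [set z | jump C z B != 0%E].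
have mk : measurable_fun setT (fun z => jump C z B) by exact: measurable_kernel.
have mZ : measurable Z.
  have := mk measurableT _ (measurableC (emeasurable_set1 0%E)); rewrite setTI.
  by congr measurable; apply/seteqP; split => w /= /eqP.
have mG := measurable_active_boundary hC.
have mY : measurable (prejump C T Q n @^-1` Z).
  by rewrite -[X in measurable X]setTI; apply: (measurable_prejump hX n).
have YZ : PP (prejump C T Q n @^-1` Z) = 0%E.
  have N1 : \forall w \ae PP, ~ (Z `&` active_boundary C) (prejump C T Q n w).
    exists (prejump C T Q n @^-1` (Z `&` active_boundary C)); split.
    - rewrite -[X in measurable X]setTI; apply: (measurable_prejump hX n) => //.
      exact: measurableI.
    - by apply: forced_jump_null; [exact: measurableI|move=> z []|exact: sZ].
    - by move=> w /= /contrapT.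
  have N2 : \forall w \ae PP, ~ alive Z (Q n w, gap n w).
    exists ((fun v => (Q n v, gap n v)) @^-1` alive Z); split.
    - rewrite -[X in measurable X]setTI; apply: (measurable_Qgap n) => //.
      exact: measurable_alive.
    - exact: sojourn_law_avoids.
    - by move=> w /= /contrapT.
  have [M [mM M0 HM]] := filterI N1 (filterI N2 (ae_gap_le_exit n)).
  apply: (subset_measure0 mY mM _ M0) => w Zw; apply: HM => -[nG [na ge]].
  have [gx|gx] := ltP (gap n w)%:E (exit_time C (Q n w)).
    apply: na; split => //=; [exact: (Q_state hX)|exact: gap_ge0].
  apply: nG; split => //; apply: exit_time_attained => //; first exact: (Q_state hX).
  by apply/eqP; rewrite eq_le gx ge.
apply/(mixture_eq0 nu P (measurable_Q_preimage n.+1 mB)).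
have := PP_null_ae mY YZ; apply: filterS2 ae_state => x sx Hx.
have hT : history T Q n n.+1 setT.
  rewrite /history; set G := [set F | _].
  have [s0 sC _] := smallest_sigma_algebra setT G.
  by have := sC _ s0; rewrite setD0.
have := postjump_law hX sx hT mB; rewrite setTI => ->.
have mf : measurable_fun setT (fun w => jump C (prejump C T Q n w) B).
  by apply: (measurableT_comp mk); exact: (measurable_prejump hX n).
have := ae_eq_integral_abs (P x) measurableT mf.
rewrite (eq_integral (fun w => jump C (prejump C T Q n w) B)); last first.
  by move=> w _; rewrite gee0_abs.
move=> [_]; apply; exists (prejump C T Q n @^-1` Z); split => //.
by move=> w /= H; apply/eqP => fw; apply: H.
Qed.

End Pdmp.

(** * Absolute continuity of the stationary distribution *)

Section AbsoluteContinuity.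
Variables (R : realType) (k : nat) (d : 'I_k.+1 -> nat).
Hypothesis hd : forall j, (0 < d j)%N.
Variables (C : characteristics R d) (dO : measure_display) (Omega : measurableType dO)
  (P : R.-pker (hybrid R d) ~> Omega) (X : R -> Omega -> hybrid R d)
  (T : nat -> Omega -> R) (Q : nat -> Omega -> hybrid R d)
  (nu : probability (hybrid R d) R).
Hypotheses (hC : is_characteristics C) (hX : is_pdmp C P X T Q).
Hypotheses (hA : assumptions_A C P T) (hB : assumptions_B C P X nu).
Variable i : 'I_k.+1.
Notation leb := (@lebesgue_measure R).
Notation PP := (mixture_probability nu P).

Let inner_part (A : set (hybrid R d)) : set 'rV[R]_(d i) :=
  existT (fun j => 'rV[R]_(d j)) i @^-1` (A `&` inner C).

(** In this range of ages the orbit is inside the domain, where its speed does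
    not vanish.  Age 0, at which the orbit may sit on the passive boundary, is
    a single point. *)
Lemma time_in_null_set A q : d i = 1%N ->
  (forall x : 'rV[R]_(d i), dom C x -> vf C x != 0) ->
  (forall x, A x -> projT1 x = i) -> lebesgue_rV (inner_part A) = 0%E ->
  state_space C q -> leb.-negligible (xsection (alive C A) q).
Proof.
move=> di hr Ai A0 sq; case: q sq => j y sq.
have [ji|ji] := eqVneq j i; last first.
  rewrite (_ : xsection _ _ = set0); first exact: negligible_set0.
  apply/seteqP; split => // u; rewrite /xsection /= inE => -[/= _ _ _ /Ai /= E].
  by rewrite E eqxx in ji.
subst j.
pose alive_times : set R := [set u | 0 < u /\ (u%:E < exit_time C (existT _ i y))%E].
have sub : xsection (alive C A) (existT _ i y) `<=`
    [set 0] `|` (alive_times `&` flow C y @^-1` inner_part A).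
  move=> u; rewrite /xsection /= inE => -[/= _ u0 ue Au].
  have [u00|u00] := eqVneq u 0; [by left|right].
  have u0' : 0 < u by rewrite lt_neqAle eq_sym u00.
  split => //; split => //; exact: (inner_before_exit hC sq u0' ue).
apply: (negligibleS sub); apply: negligibleU.
  by exists [set 0]; split; [exact: measurable_set1|exact: lebesgue_measure_set1|].
have derive_neq0 u : alive_times u ->
    exists2 df, df != 0 & is_derive u 1 (flow C y) df.
  move=> [u0 ue]; exists (vf C (flow C y u)); last exact: (orbit_is_derive hC sq u0 ue).
  by apply: hr; exact: (inner_before_exit hC sq u0 ue).
have := derive_neq0_hnull (hd i) derive_neq0 (lebesgue_rV_hnull (hd i) A0).
move: (alive_times `&` _) => S; rewrite di; exact: hnull_negligible.
Qed.

(** Every sojourn, wherever it starts, spends almost no time in [A]; sections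
    are taken along paths. *)
Lemma abs_continuous_dim1 : d i = 1%N ->
  (forall x : 'rV[R]_(d i), dom C x -> vf C x != 0) -> abs_continuous_on C i nu.
Proof.
move=> di hr A mA AE Ai A0.
apply: (null_of_sojourns hC hX (B3 hB) (B1 hB) (A3 hA) mA) => n.
apply/(product_null_xsection PP leb (measurable_ages hC hX (B3 hB) n.+1 mA)).
apply: aeW => w; have mW := measurable_xsection w (measurable_ages hC hX (B3 hB) n.+1 mA).
apply/(negligibleP leb mW).
apply: negligibleS (time_in_null_set di hr Ai A0 (Q_state hX n.+1 w)).
by move=> u; rewrite /xsection /= !inE => -[].
Qed.

(** Sections are taken at a fixed age [u] instead of along a path.  Age 0 is
    left out, as the starting point itself may be on the passive boundary. *)
Lemma abs_continuous_from_piQ (sigma : {finite_measure set (hybrid R d) -> \bar R})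
    (piQ : probability (hybrid R d) R) :
  is_boundary_measure C P T Q nu sigma -> is_piQ C nu sigma piQ ->
  abs_continuous_on C i piQ -> abs_continuous_on C i nu.
Proof.
move=> hsigma hpiQ hac A mA AE Ai A0.
apply: (null_of_sojourns hC hX (B3 hB) (B1 hB) (A3 hA) mA) => n.
apply/(product_null_ysection PP leb (measurable_ages hC hX (B3 hB) n.+1 mA)).
exists [set 0]; split; [exact: measurable_set1|exact: lebesgue_measure_set1|].
move=> u /= H; apply: contrapT => u0; apply: H.
have [ug|ul] := leP 0 u; last first.
  rewrite (_ : ysection _ _ = set0) ?measure0//.
  by apply/seteqP; split => // w; rewrite /ysection /= inE => -[[/= _]]; rewrite leNgt ul.
have {u0}u0 : 0 < u by rewrite lt_neqAle ug andbT eq_sym; apply/eqP.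
pose Au := [set q | [/\ state_space C q, (u%:E < exit_time C q)%E & A (hflow C q u)]].
have mAu : measurable Au by exact: (measurable_flow_at hC hX (B3 hB) ug mA).
have piAu : piQ Au = 0%E.
  apply: hac => //.
  - by move=> q [].
  - by move=> q [_ _ /Ai].
  apply: hnull_lebesgue_rV => //.
  have An := lebesgue_rV_hnull (hd i) A0.
  have Fn := flow_preimage_hnull (@dom_open _ _ _ _ hC i) (@flowP _ _ _ _ hC i)
    (@vf_lipschitz _ _ _ _ hC i) (hd i) ug An.
  apply: (hnull_sub _ Fn).
  move=> y [[sy ye Ay] Dy]; split.
    split => // s /andP[]; rewrite le_eqVlt => /predU1P[<- _|s0 su].
      by rewrite (flow0 (@flowP _ _ _ _ hC i) Dy).
    apply: (inner_before_exit hC sy s0).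
    by apply: le_lt_trans ye; rewrite lee_fin.
  by split => //; exact: (inner_before_exit hC sy u0 ye).
have QAu := postjump_null hC hX (B3 hB) (B1 hB) hsigma hpiQ n mAu piAu.
apply: (subset_measure0 (mu := PP) _ _ _ QAu).
- by apply: measurable_ysection; exact: (measurable_ages hC hX (B3 hB)).
- exact: (measurable_Q_preimage hX _ mAu).
- by move=> w; rewrite /ysection /= inE => -[[/= sq _ uq Aq] _]; split.
Qed.

End AbsoluteContinuity.

Theorem proposition3 (R : realType) (k : nat) (d : 'I_k.+1 -> nat)
    (hd : forall j, (0 < d j)%N)
    (C : characteristics R d) (hC : is_characteristics C)
    (dO : measure_display) (Omega : measurableType dO)
    (P : R.-pker (hybrid R d) ~> Omega) (X : R -> Omega -> hybrid R d)
    (T : nat -> Omega -> R) (Q : nat -> Omega -> hybrid R d)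
    (hX : is_pdmp C P X T Q)
    (hA : assumptions_A C P T)
    (nu : probability (hybrid R d) R) (hB : assumptions_B C P X nu)
    (sigma : {finite_measure set (hybrid R d) -> \bar R})
    (hsigma : is_boundary_measure C P T Q nu sigma)
    (piQ : probability (hybrid R d) R) (hpiQ : is_piQ C nu sigma piQ)
    (hT1 : (expect C P piQ (fun w => (T 1%N w)%:E) < +oo)%E)
    (i : 'I_k.+1)
    (hr : forall x : 'rV[R]_(d i), dom C x -> vf C x != 0) :
  (d i = 1%N -> abs_continuous_on C i nu) /\
  (abs_continuous_on C i piQ ->
   continuously_differentiable (@dom R k d C i) (@vf R k d C i) ->
   abs_continuous_on C i nu).
Proof.
split=> [di|hac _]; first exact: (abs_continuous_dim1 hd hC hX hA hB di hr).
exact: (abs_continuous_from_piQ hd hC hX hA hB hsigma hpiQ hac).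
Qed.
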